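(* Let $A \in \mathbb{R}^{d\times n}$, let $k, m$ be positive integers and $\epsilon, \delta \in (0,1]$. Let $A = B + N$ be an optimal decomposition for PCA with outliers, i.e. $N$ has at most $m$ non-zero columns, $B$ is zero on the non-zero columns of $N$ and equals $A$ on the remaining columns, and $\|B - B_k\|_F^2$ is minimal among all such decompositions, where $B_k$ denotes a best rank-$k$ approximation of $B$. There is an efficient (polynomial-time) algorithm that takes as input $A, k, m, \epsilon, \delta$ and outputs a decomposition $A = B' + N'$ (each column of $A$ placed either in $B'$ or in $N'$, the other matrix being zero in that column) along with a subspace $V$ such that: (a) $N'$ has at most $(1+\delta)m$ non-zero columns; (b) $\|\Pi_V^\perp B'\|_F^2 \le (1+\epsilon)\|B - B_k\|_F^2$; (c) $V$ is the span of a subset of the columns of $A$ of size at most $O\!\left(\frac{k}{\epsilon^6}\left(\log(n/m) + \frac{2}{\delta}\right)\right)$.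
   Context: $\Pi_V^\perp$ denotes the orthogonal projection onto the orthogonal complement of the subspace $V$. *)

(* Defs.v *)
From HB Require Import structures.
From mathcomp Require Import all_boot all_order all_algebra.
From mathcomp Require Import all_classical all_reals all_analysis.

Set Implicit Arguments.
Unset Strict Implicit.
Unset Printing Implicit Defensive.

Import Order.TTheory GRing.Theory Num.Theory.
Local Open Scope ring_scope.

Section LinearAlgebra.
Variable R : realType.

Definition frob2 d n (M : 'M[R]_(d, n)) : R := \sum_i \sum_j M i j ^+ 2.

(* Euclidean inner product on R^d; the instances below make the library's
   orthogonal complement [orthov] available for it. *)
Definition dotv d (u v : 'cV[R]_d) : R := (u^T *m v) 0 0.

Lemma dotvE d (u v : 'cV[R]_d) : dotv u v = \sum_i u i 0 * v i 0.
Proof. by rewrite /dotv mxE; apply: eq_bigr => i _; rewrite mxE. Qed.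

Lemma dotvC d (u v : 'cV[R]_d) : dotv u v = dotv v u.
Proof. by rewrite !dotvE; apply: eq_bigr => i _; rewrite mulrC. Qed.

Fact dotv_linearl d (v : 'cV[R]_d) :
  GRing.linear_for *%R (fun u : 'cV[R]_d => dotv u v).
Proof.
move=> a u w; rewrite !dotvE mulr_sumr -big_split /=.
by apply: eq_bigr => i _; rewrite !mxE mulrDl mulrA.
Qed.

Fact dotv_linearr d (u : 'cV[R]_d) :
  GRing.linear_for (idfun \; *%R) (fun v : 'cV[R]_d => dotv u v).
Proof. by move=> a v w /=; rewrite !(dotvC u) dotv_linearl. Qed.

HB.instance Definition _ d :=
  bilinear_isBilinear.Build R 'cV[R]_d 'cV[R]_d R *%R (idfun \; *%R) (@dotv d)
    (@dotv_linearl d, @dotv_linearr d).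

Fact dotv_herm d (u v : 'cV[R]_d) :
  dotv u v = (-1) ^+ false * idfun (dotv v u).
Proof. by rewrite expr0 mul1r dotvC. Qed.

HB.instance Definition _ d :=
  isHermitianSesquilinear.Build R 'cV[R]_d false idfun (@dotv d) (@dotv_herm d).

Definition orthocompl d (V : {vspace 'cV[R]_d}) : {vspace 'cV[R]_d} :=
  orthov (@dotv d) V.

Definition perp_proj d (V : {vspace 'cV[R]_d}) : 'End('cV[R]_d) :=
  daddv_pi (orthocompl V) V.

Definition map_cols d n (f : 'End('cV[R]_d)) (M : 'M[R]_(d, n)) : 'M[R]_(d, n) :=
  \matrix_(i, j) f (col j M) i 0.

Definition col_span d n (M : 'M[R]_(d, n)) (S : {set 'I_n}) : {vspace 'cV[R]_d} :=
  <<[seq col j M | j in S]>>%VS.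

Lemma dotv_eq0 d (u : 'cV[R]_d) : (dotv u u == 0) = (u == 0).
Proof.
rewrite dotvE; apply/idP/eqP => [|->]; last first.
  by rewrite big1 // => i _; rewrite mxE mul0r.
move/eqP/psumr_eq0P => u0; apply/colP => i; rewrite mxE.
by apply/eqP; rewrite -sqrf_eq0 expr2 u0 // => j _; rewrite -expr2 sqr_ge0.
Qed.

Lemma orthocomplP d (V : {vspace 'cV[R]_d}) (u : 'cV[R]_d) :
  reflect {in V, forall v, dotv u v = 0} (u \in orthocompl V).
Proof. exact: mem_orthovP. Qed.

Lemma capv_orthocompl d (V : {vspace 'cV[R]_d}) : (orthocompl V :&: V = 0)%VS.
Proof.
apply/eqP; rewrite -subv0; apply/subvP => u; rewrite memv_cap memv0.
by case/andP => /orthocomplP Vu /Vu/eqP; rewrite dotv_eq0.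
Qed.

Lemma dim_orthocompl_span d (s : seq 'cV[R]_d) :
  (\dim {: 'cV[R]_d} <= size s + \dim (orthocompl << s >>))%N.
Proof.
elim: s => [|v s IHs]; first by rewrite span_nil /orthocompl orthov0.
rewrite (leq_trans IHs) //= addSnnS leq_add2l.
have := leq_dim_orthov1 (@dotv d) v (orthocompl << s >>).
rewrite -[X in (X <= _)%N -> _]subn1 leq_subLR add1n => /leq_trans -> //.
rewrite ltnS dimvS //; apply/subvP => u; rewrite memv_cap.
case/andP => /orthocomplP us; rewrite mem_orthov1 => /eqP uv.
apply/orthocomplP => w; rewrite span_cons => /memv_addP[a /vlineP[c ->] [b sb ->]].
by rewrite linearDr /= linearZr_LR /= (us _ sb) [dotv u v]uv /= mulr0 addr0.
Qed.

Lemma addv_orthocompl d (V : {vspace 'cV[R]_d}) : (orthocompl V + V = fullv)%VS.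
Proof.
apply/eqP; rewrite eqEdim subvf /= dimv_disjoint_sum ?capv_orthocompl //.
have := dim_orthocompl_span (vbasis V).
by rewrite (span_basis (vbasisP V)) size_tuple addnC.
Qed.

Lemma perp_projP d (V : {vspace 'cV[R]_d}) (u : 'cV[R]_d) :
  perp_proj V u \in orthocompl V /\ u - perp_proj V u \in V.
Proof.
split; first exact: memv_pi.
have uV : u \in (orthocompl V + V)%VS by rewrite addv_orthocompl memvf.
rewrite -{1}(daddv_pi_add (capv_orthocompl V) uV) addrC addKr.
exact: memv_pi.
Qed.

End LinearAlgebra.

Section Decompositions.
Variables (R : realType) (d n : nat).
Implicit Types (A B N X : 'M[R]_(d, n)) (k m : nat).

Definition nzcols N : {set 'I_n} := [set j | col j N != 0].

Definition outlier_decomp A m B N : Prop :=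
  [/\ A = B + N,
      (#|nzcols N| <= m)%N
    & forall j, col j B = if j \in nzcols N then 0 else col j A].

Definition best_rank_approx k B Bk : Prop :=
  (\rank Bk <= k)%N /\
  forall X, (\rank X <= k)%N -> frob2 (B - Bk) <= frob2 (B - X).

Definition optimal_decomp A k m B N Bk : Prop :=
  [/\ outlier_decomp A m B N,
      best_rank_approx k B Bk
    & forall B1 N1 B1k, outlier_decomp A m B1 N1 -> best_rank_approx k B1 B1k ->
        frob2 (B - Bk) <= frob2 (B1 - B1k)].

Definition column_split A B N : Prop :=
  A = B + N /\
  forall j, (col j B = col j A /\ col j N = 0) \/
            (col j B = 0 /\ col j N = col j A).

End Decompositions.

(** Deterministic algorithms are programs of a small imperative language over
    two-sorted memory: cells holding natural numbers and cells holding exact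
    reals, addressed by an array name and two natural-number indices (scalars
    sit at indices 0, 0).  This is the real RAM (Blum-Shub-Smale) model of
    polynomial time, with these restrictions:
    - the syntax has no real literals, so a program cannot hide real-valued
      advice, and it does not mention the dimensions, so that one program
      serves inputs of all sizes;
    - reals cannot be rounded or converted to natural numbers, and are only
      inspected through comparisons;
    - natural numbers have no unit-cost multiplication, so that numbers
      produced in T steps have O(T) bits. *)

Inductive nexp : Type :=
| NLit of nat
| NGet of nat & nexp & nexp
| NAdd of nexp & nexp
| NSub of nexp & nexp.

Inductive rexp : Type :=
| RNat of nexp
| RGet of nat & nexp & nexp
| RAdd of rexp & rexp
| RSub of rexp & rexp
| RMul of rexp & rexp
| RDiv of rexp & rexp.

Inductive bexp : Type :=
| NLt of nexp & nexp
| RLt of rexp & rexp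
| BNot of bexp
| BAnd of bexp & bexp.

Inductive cmd : Type :=
| Skip
| NSet of nat & nexp & nexp & nexp
| RSet of nat & nexp & nexp & rexp
| Seq of cmd & cmd
| If of bexp & cmd & cmd
| While of bexp & cmd.

Section Machine.
Variable R : realType.

Definition memory (T : Type) : Type := nat -> nat -> nat -> T.

Definition upd T (f : memory T) (x i j : nat) (v : T) : memory T :=
  fun y a b => if [&& y == x, a == i & b == j] then v else f y a b.

Record state : Type := State { nmem : memory nat; rmem : memory R }.

Fixpoint neval (s : state) (e : nexp) : nat :=
  match e with
  | NLit c => c
  | NGet x e1 e2 => nmem s x (neval s e1) (neval s e2)
  | NAdd e1 e2 => neval s e1 + neval s e2
  | NSub e1 e2 => neval s e1 - neval s e2
  end%N.

(* Division by zero returns zero, as everywhere in the library. *)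
Fixpoint reval (s : state) (e : rexp) : R :=
  match e with
  | RNat e1 => (neval s e1)%:R
  | RGet x e1 e2 => rmem s x (neval s e1) (neval s e2)
  | RAdd e1 e2 => reval s e1 + reval s e2
  | RSub e1 e2 => reval s e1 - reval s e2
  | RMul e1 e2 => reval s e1 * reval s e2
  | RDiv e1 e2 => reval s e1 / reval s e2
  end.

Fixpoint beval (s : state) (b : bexp) : bool :=
  match b with
  | NLt e1 e2 => (neval s e1 < neval s e2)%N
  | RLt e1 e2 => reval s e1 < reval s e2
  | BNot b1 => ~~ beval s b1
  | BAnd b1 b2 => beval s b1 && beval s b2
  end.

(* One step executes one assignment, evaluates one test or unfolds one sequence.
   For a fixed program the expressions have bounded size, so the number of steps
   is the number of elementary operations up to a constant factor.  A
   configuration is the stack of commands still to be run and the memory; the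
   machine has halted when the stack is empty. *)
Definition step (cs : seq cmd * state) : seq cmd * state :=
  let: (ks, s) := cs in
  match ks with
  | [::] => ([::], s)
  | Skip :: ks' => (ks', s)
  | NSet x e1 e2 e :: ks' =>
      (ks', State (upd (nmem s) x (neval s e1) (neval s e2) (neval s e)) (rmem s))
  | RSet x e1 e2 e :: ks' =>
      (ks', State (nmem s) (upd (rmem s) x (neval s e1) (neval s e2) (reval s e)))
  | Seq p q :: ks' => (p :: q :: ks', s)
  | If b p q :: ks' => ((if beval s b then p else q) :: ks', s)
  | While b p :: ks' => (if beval s b then p :: While b p :: ks' else ks', s)
  end.

Definition halts_within (P : cmd) (s0 : state) (T : nat) (s1 : state) : Prop :=
  exists2 t, (t <= T)%N & iter t step ([:: P], s0) = ([::], s1).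

(* Input: d, n, k, m in natural scalars 0, 1, 2, 3; A in real array 0;
   eps and delta in real scalars 1 and 2.  All other cells are zero. *)
Definition input_state d n (A : 'M[R]_(d, n)) (k m : nat) (eps delta : R) : state :=
  State
    (fun x i j => if (i == 0) && (j == 0) then nth 0 [:: d; n; k; m] x else 0)%N
    (fun x i j =>
       match x with
       | 0%N => match insub i, insub j with
                | Some i', Some j' => A i' j'
                | _, _ => 0
                end
       | 1%N => if (i == 0%N) && (j == 0%N) then eps else 0
       | 2%N => if (i == 0%N) && (j == 0%N) then delta else 0
       | _ => 0
       end).

Definition read_mx (s : state) (x d n : nat) : 'M[R]_(d, n) :=
  \matrix_(i, j) rmem s x i j.

(* Output: B' and N' in real arrays 3 and 4; the subspace V is presented by the
   d x n array 5, whose columns span it. *)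
Definition outputs (s : state) d n (B' N' : 'M[R]_(d, n)) (V : {vspace 'cV[R]_d}) :
    Prop :=
  [/\ B' = read_mx s 3 d n, N' = read_mx s 4 d n
    & V = col_span (read_mx s 5 d n) [set: 'I_n]].

End Machine.

(* Main.v *)
Require Import Defs.
From mathcomp Require Import all_boot all_order all_algebra.
From mathcomp Require Import all_classical all_reals all_analysis.
From mathcomp Require Import ring lra zify.

(** Let [U] be a set of columns that are close to a [k]-dimensional
    subspace. Applying the orthogonal projection onto the row space of their
    rank-[k] approximation shows that the squared distances of the columns
    of [U] to the span of the other columns of [U], weighted by (1 -
    leverage)^2, add up to at most the approximation error. As the leverages
    add up to at most [k], if [#|U|] is at least [k / kappa] then some
    column of [U] is, up to a factor (1 - kappa)^-2, as close to the span of
    the others as the worst column of [U] is to the subspace.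

    Call a set [B] of columns of [T] stable if every column of [T] outside
    [B] is, up to a factor [1 + eta], as close to the span of [B] as any
    column of [B] is to the span of the rest of [B]. An exchange of two
    columns that violate this multiplies the squared volume of [B] by more
    than [1 + eta]. Hence local search from a greedily chosen set finds a
    stable set after polynomially many exchanges, because the volume of a
    greedy set of size [b] is within a factor [b!] of the maximum (the
    leave-one-out estimate again).

    In one round, with [t] active columns, take off [p] disjoint stable sets
    of equal size one after the other. At least [t - m] active columns are
    inliers; by pigeonhole one of the stable sets contains about [16 k /
    eps] of the cheapest of them, and its span is then close to all columns
    remaining after it. The round keeps the set whose span has the smallest
    maximal distance to the columns remaining after it, and moves about [eps
    (t - m) / 16] of these to [B']. The prices paid over all rounds are
    charged to the optimal costs of the inliers by comparing, for every
    threshold, how many of them exceed it; the sizes of the chosen sets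
    telescope against the potential [ln x - m / x] with [x = t - m]. *)

Set Implicit Arguments.
Unset Strict Implicit.
Unset Printing Implicit Defensive.

Import Order.TTheory GRing.Theory Num.Theory.
Local Open Scope ring_scope.

(** * The leave-one-out estimate *)

Section Distance.
Variables (R : realType) (d : nat).
Implicit Types (V W : {vspace 'cV[R]_d}) (a b v x y : 'cV[R]_d).

Definition dist2 V a : R := dotv (perp_proj V a) (perp_proj V a).

Lemma dotvv_ge0 a : 0 <= dotv a a.
Proof. by rewrite dotvE sumr_ge0 // => i _; rewrite -expr2 sqr_ge0. Qed.

Lemma dotvDl a b v : dotv (a + b) v = dotv a v + dotv b v.
Proof. by rewrite linearDl. Qed.
Lemma dotvDr a b v : dotv v (a + b) = dotv v a + dotv v b.
Proof. by rewrite linearDr. Qed.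
Lemma dotvBl a b v : dotv (a - b) v = dotv a v - dotv b v.
Proof. by rewrite linearBl. Qed.
Lemma dotvBr a b v : dotv v (a - b) = dotv v a - dotv v b.
Proof. by rewrite linearBr. Qed.
Lemma dotvZl c b v : dotv (c *: b) v = c * dotv b v.
Proof. by rewrite linearZl_LR. Qed.
Lemma dotvZr c b v : dotv v (c *: b) = c * dotv v b.
Proof. by rewrite linearZr_LR. Qed.

Lemma dist2_ge0 V a : 0 <= dist2 V a.
Proof. exact: dotvv_ge0. Qed.

Lemma perp_projE V a b : b \in orthocompl V -> a - b \in V -> perp_proj V a = b.
Proof.
move=> b_perp abV; have [p_perp apV] := perp_projP V a.
apply/eqP; rewrite -subr_eq0 -memv0 -(capv_orthocompl V) memv_cap.
rewrite rpredB //=.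
have -> : perp_proj V a - b = (a - b) - (a - perp_proj V a).
  by rewrite opprB [RHS]addrC addrA subrK.
by rewrite rpredB.
Qed.

Lemma dotv_perp V a v : v \in V -> dotv (perp_proj V a) v = 0.
Proof. by move=> vV; have [/orthocomplP/(_ _ vV)] := perp_projP V a. Qed.

Lemma dotv_proj V a b : dotv (perp_proj V a) b = dotv (perp_proj V a) (perp_proj V b).
Proof.
rewrite -{1}(subrK (perp_proj V b) b) dotvDr dotv_perp ?add0r //.
by have [] := perp_projP V b.
Qed.

Lemma perp_proj_eq0 V a : a \in V -> perp_proj V a = 0.
Proof. by move=> aV; apply: perp_projE; rewrite ?subr0 // mem0v. Qed.

Lemma dist2_le V a v : v \in V -> dist2 V a <= dotv (a - v) (a - v).
Proof.
move=> vV; have [_ apV] := perp_projP V a.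
have -> : a - v = perp_proj V a + (a - perp_proj V a - v) by rewrite addrA subrKC.
set p := perp_proj V a.
have : a - p - v \in V by rewrite rpredB.
move: (a - p - v) => w wV.
rewrite dotvDl !dotvDr (dotvC w p) (dotv_perp _ wV) add0r addr0.
by rewrite lerDl dotvv_ge0.
Qed.

Lemma dist2_le0 V a : dist2 V a <= dotv a a.
Proof. by have := dist2_le a (mem0v V); rewrite subr0. Qed.

Lemma dist2_sub V W a : (V <= W)%VS -> dist2 W a <= dist2 V a.
Proof.
move=> /subvP VW; have [_ apV] := perp_projP V a.
by have := dist2_le a (VW _ apV); rewrite subKr.
Qed.

Lemma dist2_mem V a : a \in V -> dist2 V a = 0.
Proof. by move=> /perp_proj_eq0; rewrite /dist2 => ->; apply/eqP; rewrite dotv_eq0. Qed.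

(* [x'] may vanish: the quotient is then [0], which is what the formula needs. *)
Lemma perp_proj_add V x a :
  let x' := perp_proj V x in let a' := perp_proj V a in
  perp_proj (V + <[x]>) a = a' - (dotv a' x' / dotv x' x') *: x'.
Proof.
move=> x' a'; have [x'_perp xx'V] := perp_projP V x.
have [a'_perp aa'V] := perp_projP V a.
set c := _ / _; have b_perp : a' - c *: x' \in orthocompl V by rewrite rpredB ?rpredZ.
have bx' : dotv (a' - c *: x') x' = 0.
  rewrite dotvBl dotvZl /c; have [/eqP|x'0] := eqVneq (dotv x' x') 0.
    by rewrite dotv_eq0 => /eqP ->; rewrite linear0r !mul0r subr0.
  by rewrite divfK // subrr.
have bx : dotv (a' - c *: x') x = 0.
  have /orthocomplP/(_ _ xx'V) := b_perp.
  by rewrite dotvBr bx' subr0.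
apply: perp_projE.
  apply/orthocomplP => w /memv_addP[v vV [_ /vlineP[e ->] ->]].
  rewrite dotvDr dotvZr bx mulr0 addr0.
  by have /orthocomplP/(_ _ vV) := b_perp.
rewrite opprB addrCA addrC; apply: rpredD.
  by apply: subvP aa'V; apply: addvSl.
apply: rpredZ; rewrite -[x'](subKr x); apply: rpredB.
  by apply: subvP (memv_line x); apply: addvSr.
by apply: subvP xx'V; apply: addvSl.
Qed.

Lemma dist2_add V x a :
  dist2 (V + <[x]>) a =
  dist2 V a - dotv (perp_proj V a) (perp_proj V x) ^+ 2 / dist2 V x.
Proof.
rewrite /dist2 perp_proj_add /=; set x' := perp_proj V x; set a' := perp_proj V a.
set c := _ / _; rewrite dotvBl !dotvBr !dotvZl !dotvZr (dotvC x' a') /c.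
have [/eqP|x'0] := eqVneq (dotv x' x') 0.
  by rewrite dotv_eq0 => /eqP ->; rewrite !linear0r; ring.
by field.
Qed.

(** Both sides are the Gram determinant of the projections of [x] and [y] away from [V], which is
    symmetric. This makes the volume below independent of the order of the columns. *)
Lemma dist2_addC V x y :
  dist2 V x * dist2 (V + <[x]>) y = dist2 V y * dist2 (V + <[y]>) x.
Proof.
have E z t : dist2 V z * dist2 (V + <[z]>) t
    = dist2 V z * dist2 V t - dotv (perp_proj V t) (perp_proj V z) ^+ 2.
  rewrite dist2_add mulrBr mulrCA; have [z0|z0] := eqVneq (dist2 V z) 0.
    suff -> : perp_proj V z = 0 by rewrite linear0r expr0n /= mul0r subr0.
    by apply/eqP; rewrite -dotv_eq0; apply/eqP.
  by rewrite divff // mulr1.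
by rewrite E [RHS]E mulrC (dotvC (perp_proj V y)).
Qed.

End Distance.

(** * Leverages and the leave-one-out inequality *)

Section LeaveOneOut.
Variables (R : realType) (d n : nat).
Implicit Types (U : {set 'I_n}).

Definition evec (j : 'I_n) : 'cV[R]_n := delta_mx j 0.

Lemma dotv_evec (v : 'cV[R]_n) j : dotv v (evec j) = v j 0.
Proof.
rewrite dotvE (bigD1 j) //= big1 ?mxE ?eqxx ?mulr1 ?addr0 // => i ij.
by rewrite mxE (negPf ij) mulr0.
Qed.

(** As the projection is self-adjoint, the summands are the squared coordinates of the projection of
    [v]. *)
Lemma sum_dotv_evec (V : {vspace 'cV[R]_n}) (v : 'cV[R]_n) :
  \sum_j dotv (perp_proj V (evec j)) v ^+ 2 = dist2 V v.
Proof.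
rewrite /dist2 [RHS]dotvE; apply: eq_bigr => j _.
rewrite -expr2; congr (_ ^+ 2).
by rewrite dotv_proj dotvC -dotv_proj dotv_evec.
Qed.

(** The sum is the trace of the projection onto the orthogonal complement. Adjoining a vector to the
    span lowers it by 1, or by 0 if the vector lies in the span already. *)
Lemma sum_dist2_evec (s : seq 'cV[R]_n) :
  n%:R - (size s)%:R <= \sum_j dist2 << s >>%VS (evec j).
Proof.
elim: s => [|x s IHs].
  rewrite subr0 span_nil (eq_bigr (fun=> 1)) ?sumr_const ?card_ord // => j _.
  have -> : dist2 0 (evec j) = dotv (evec j) (evec j).
    rewrite /dist2 (@perp_projE _ _ _ _ (evec j)) ?subrr ?mem0v //.
    by apply/orthocomplP => v; rewrite memv0 => /eqP ->; rewrite linear0r.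
  by rewrite dotv_evec mxE !eqxx.
rewrite span_cons addvC; under eq_bigr do rewrite dist2_add dotvC -dotv_proj dotvC.
rewrite sumrB -mulr_suml.
have -> : \sum_j dotv (evec j) (perp_proj << s >>%VS x) ^+ 2 = dist2 << s >>%VS x.
  by rewrite /dist2 [RHS]dotvE; apply: eq_bigr => j _; rewrite dotvC dotv_evec expr2.
have : dist2 << s >>%VS x / dist2 << s >>%VS x <= 1.
  by have [->|x0] := eqVneq (dist2 << s >>%VS x) 0; rewrite ?mul0r ?ler01 ?divff.
by move: IHs; rewrite /= -[(size s).+1]addn1 natrD; lra.
Qed.


Lemma mem_col_span (A : 'M[R]_(d, n)) U j : j \in U -> col j A \in col_span A U.
Proof. by move=> jU; apply/memv_span/mapP; exists j; rewrite ?mem_enum. Qed.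

Lemma col_span_sub (A : 'M[R]_(d, n)) U U' :
  U \subset U' -> (col_span A U <= col_span A U')%VS.
Proof.
move=> /fintype.subsetP UU'; apply/span_subvP => _ /mapP[j jU ->].
by apply: mem_col_span; rewrite UU' // -mem_enum.
Qed.

Lemma col_span0 (A : 'M[R]_(d, n)) : col_span A finset.set0 = 0%VS.
Proof.
rewrite /col_span (_ : [seq _ | j in _] = [::]) ?span_nil //.
by apply: size0nil; rewrite size_image cards0.
Qed.

Lemma col_spanU1 (A : 'M[R]_(d, n)) U j :
  col_span A (j |: U) = (col_span A U + <[col j A]>)%VS.
Proof.
rewrite addvC -span_cons; apply: eq_span => v; rewrite inE.
apply/mapP/predU1P => [[i]|[->|/mapP[i]]].
- rewrite mem_enum !inE => /predU1P[->|iU ->]; [by left|right].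
  by apply/mapP; exists i; rewrite ?mem_enum.
- by exists j; rewrite // mem_enum setU11.
by rewrite mem_enum => iU ->; exists i; rewrite // mem_enum inE iU orbT.
Qed.

(* [w j] is one minus the leverage of column [j] for the row space of the part
   of [X] supported on [U]; the weights sum to at least [#|U| - rank X]. *)
Lemma leave_one_out (A X : 'M[R]_(d, n)) U :
  let loo j := dist2 (col_span A (U :\ j)) (col j A) in
  exists w : 'I_n -> R,
    #|U|%:R - (\rank X)%:R <= \sum_(j in U) w j /\
    \sum_(j in U) w j ^+ 2 * loo j
      <= \sum_(j in U) dotv (col j A - col j X) (col j A - col j X).
Proof.
move=> loo.
(* The [Z l] span the row space of [X] cut off outside [U], and [q j] is column [j] of the
   projection onto the orthogonal complement of that span. *)
pose Z l : 'cV[R]_n := \col_j (if j \in U then row_base X l j else 0).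
pose V := << [seq Z l | l <- enum 'I_(\rank X)]>>%VS.
pose q j := perp_proj V (evec j).
exists (fun j => dist2 V (evec j)).
have wE j : dist2 V (evec j) = q j j 0 by rewrite /dist2 -dotv_proj dotv_evec.
have qZ j l : dotv (q j) (Z l) = 0.
  by apply/dotv_perp/memv_span/map_f; rewrite mem_enum.
have wout j : j \notin U -> dist2 V (evec j) = 1.
  move=> jU; rewrite /dist2 (@perp_projE _ _ _ _ (evec j)) ?subrr ?mem0v //.
    by rewrite dotv_evec mxE !eqxx.
  have VU : {in V, forall v : 'cV[R]_n, v j 0 = 0}.
    move=> v /coord_span ->; rewrite summxE big1 // => i _; rewrite mxE.
    suff -> : ([seq Z l | l <- enum 'I_(\rank X)]`_i) j 0 = 0 by rewrite mulr0.
    have /mapP[l _ ->] : [seq Z l | l <- enum 'I_(\rank X)]`_i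
        \in [seq Z l | l <- enum 'I_(\rank X)] by rewrite mem_nth // size_map -cardE.
    by rewrite mxE (negPf jU).
  by apply/orthocomplP => v vV; rewrite dotvC dotv_evec VU.
split.
  have := sum_dist2_evec [seq Z l | l <- enum 'I_(\rank X)].
  rewrite size_map size_enum_ord -/V (bigID (mem U)) /=.
  have -> : \sum_(i | i \notin U) dist2 V (evec i) = #|~: U|%:R.
    rewrite -sumr_const; apply: eq_big => [i|i /wout //]; by rewrite inE.
  have : n%:R = #|U|%:R + #|~: U|%:R :> R by rewrite -natrD cardsC card_ord.
  by lra.
(* The combination [y j] is read in two ways. Modulo the other columns of [U] it is the weight of
   [j] times column [j]; and since its coefficients annihilate [X] on [U], it is the same
   combination of the error columns. *)
pose y j := \sum_(i in U) q j i 0 *: col i A.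
have XqE j r : \sum_(i in U) q j i 0 * X r i = 0.
  rewrite -{1}(mulmx_base X); under eq_bigr do rewrite mxE mulr_sumr.
  rewrite exchange_big big1 //= => l _.
  under eq_bigr do rewrite mulrCA; rewrite -mulr_sumr.
  suff -> : \sum_(i in U) q j i 0 * row_base X l i = dotv (q j) (Z l).
    by rewrite qZ mulr0.
  rewrite dotvE [RHS](bigID (mem U)) /= [X in _ + X]big1 ?addr0.
    by apply: eq_bigr => i iU; rewrite [Z l i 0]mxE iU.
  by move=> i /negPf iU; rewrite mxE iU mulr0.
have yloo j : j \in U -> dist2 V (evec j) ^+ 2 * loo j <= dotv (y j) (y j).
  move=> jU; apply: le_trans (dist2_le0 (col_span A (U :\ j)) (y j)).
  rewrite /dist2 -/(dist2 V (evec j)).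
  have -> : perp_proj (col_span A (U :\ j)) (y j)
      = dist2 V (evec j) *: perp_proj (col_span A (U :\ j)) (col j A).
    rewrite /y (bigD1 j) //= linearD linearZ /= linear_sum /= big1 ?addr0 ?wE //.
    move=> i /andP[iU ij]; rewrite linearZ /= perp_proj_eq0 ?scaler0 //.
    by apply: mem_col_span; rewrite !inE ij.
  by rewrite dotvZl dotvZr mulrA -expr2.
pose E r : 'cV[R]_n := \col_i (if i \in U then A r i - X r i else 0).
have yE j r : y j r 0 = dotv (q j) (E r).
  rewrite /y summxE dotvE [RHS](bigID (mem U)) /= [X in _ + X]big1 ?addr0.
    rewrite -[LHS]subr0 -[X in _ - X = _](XqE j r) -sumrB; apply: eq_bigr => i iU.
    by rewrite !mxE iU mulrBr.
  by move=> i /negPf iU; rewrite mxE iU mulr0.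
apply: (@le_trans _ _ (\sum_(j in U) dotv (y j) (y j))); first exact: ler_sum.
apply: (@le_trans _ _ (\sum_j dotv (y j) (y j))).
  by rewrite [leRHS](bigID (mem U)) /= lerDl sumr_ge0 // => j _; apply: dotvv_ge0.
under eq_bigr do rewrite dotvE; rewrite exchange_big /=.
under [leRHS]eq_bigr do rewrite dotvE; rewrite [leRHS]exchange_big /=.
apply: ler_sum => r _.
under eq_bigr do rewrite yE -expr2.
(* For a fixed row [r], the squares add up to the squared norm of the projection of the error row
   [E r], which is at most that of [E r] itself. *)
rewrite sum_dotv_evec (le_trans (dist2_le0 _ _)) // dotvE (bigID (mem U)) /=.
rewrite [X in _ + X]big1 ?addr0.
  by apply: ler_sum => i iU; rewrite !mxE iU.
by move=> i /negPf iU; rewrite mxE iU mulr0.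
Qed.

(** The column with the least leave-one-out distance works: by [leave_one_out] this distance times
    the sum of the squared weights is at most [#|U| * v], and Cauchy-Schwarz bounds the sum of
    squares below through the sum of the weights, which is at least [#|U| - k]. *)
Lemma exists_loo_le (A X : 'M[R]_(d, n)) U k v :
    (\rank X <= k)%N -> (k < #|U|)%N ->
    (forall j, j \in U -> dotv (col j A - col j X) (col j A - col j X) <= v) ->
  exists2 j, j \in U &
    dist2 (col_span A (U :\ j)) (col j A) * (#|U|%:R - k%:R) ^+ 2 <= #|U|%:R ^+ 2 * v.
Proof.
move=> Xk kU Uv; have [w [w1 w2]] := leave_one_out A X U.
pose loo j := dist2 (col_span A (U :\ j)) (col j A).
have [j0 j0U] : exists j, j \in U by apply/set0Pn; rewrite -card_gt0; lia.
case: (arg_minP loo j0U) => j jU jmin.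
exists j => //; rewrite -/(loo j).
(* Cauchy-Schwarz, obtained from the nonnegativity of the variance of the weights. *)
have cs : (\sum_(i in U) w i) ^+ 2 <= #|U|%:R * \sum_(i in U) w i ^+ 2.
  set c := \sum_(i in U) w i; have U0 : 0 < #|U|%:R :> R by rewrite ltr0n; lia.
  have : 0 <= \sum_(i in U) (#|U|%:R * w i - c) ^+ 2.
    by apply: sumr_ge0 => i _; apply: sqr_ge0.
  rewrite (eq_bigr (fun i => #|U|%:R ^+ 2 * w i ^+ 2 - 2 * #|U|%:R * c * w i + c ^+ 2)).
    rewrite big_split sumrB /= sumr_const -!mulr_sumr -/c -[c ^+ 2 *+ _]mulr_natr.
    set W := \sum_(i in U) _.
    have -> : #|U|%:R ^+ 2 * W - 2 * #|U|%:R * c * c + c ^+ 2 * #|U|%:R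
      = #|U|%:R * (#|U|%:R * W - c ^+ 2) by ring.
    by rewrite pmulr_rge0 // subr_ge0.
  by move=> i _; ring.
have rk : (\rank X)%:R <= k%:R :> R by rewrite ler_nat.
have kU' : k%:R < #|U|%:R :> R by rewrite ltr_nat.
have loo0 : 0 <= loo j by apply: dist2_ge0.
have step1 : loo j * (#|U|%:R - k%:R) ^+ 2 <= loo j * (\sum_(i in U) w i) ^+ 2.
  by apply: ler_wpM2l => //; apply: lerXn2r; rewrite ?nnegrE; lra.
apply: le_trans step1 _; apply: le_trans (ler_wpM2l loo0 cs) _.
rewrite mulrCA expr2 -mulrA; apply: ler_wpM2l => //.
rewrite mulr_sumr; apply: (@le_trans _ _ (\sum_(i in U) w i ^+ 2 * loo i)).
  by apply: ler_sum => i iU; rewrite mulrC ler_wpM2l ?sqr_ge0 // jmin.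
apply: le_trans w2 _; rewrite mulr_natl -sumr_const.
exact: ler_sum.
Qed.

End LeaveOneOut.

(** * Volumes, greedy sets and stable sets *)

Section Volume.
Variables (R : realType) (d n : nat) (A : 'M[R]_(d, n)).
Implicit Types (V : {vspace 'cV[R]_d}) (s t : seq 'I_n) (B T U : {set 'I_n}).

Local Notation resid B i := (dist2 (col_span A B) (col i A)).

(* [volv 0 s] is the Gram determinant of the columns listed in [s]. *)
Fixpoint volv V s : R :=
  if s is j :: s' then dist2 V (col j A) * volv (V + <[col j A]>)%VS s' else 1.

Definition vol B : R := volv 0%VS (enum B).

Lemma volv_mid V s j t : volv V (s ++ j :: t) = volv V (j :: s ++ t).
Proof.
elim: s V => [//|i s IHs] V /=; rewrite IHs /= !mulrA dist2_addC.
by rewrite -!addvA (addvC <[col j A]>%VS).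
Qed.

Lemma perm_volv V s t : perm_eq s t -> volv V s = volv V t.
Proof.
elim: s t V => [|j s IHs] t V; first by rewrite perm_sym => /perm_nilP ->.
move=> st; have /path.splitPr jt : j \in t by rewrite -(perm_mem st) mem_head.
case: jt st => t1 t2 st; rewrite volv_mid /=; congr (_ * _); apply: IHs.
by rewrite -(perm_cons j) (perm_trans st) // -cat1s perm_catCA.
Qed.

Lemma volv_rcons V s j :
  volv V (rcons s j) = volv V s * dist2 (V + << [seq col i A | i <- s] >>) (col j A).
Proof.
elim: s V => [|i s IHs] V /=; first by rewrite span_nil addv0 mul1r mulr1.
by rewrite IHs mulrA span_cons addvA.
Qed.

Lemma volv_ge0 V s : 0 <= volv V s.
Proof.
elim: s V => [|i s IHs] V /=; first exact: ler01.
by rewrite mulr_ge0 ?dist2_ge0.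
Qed.

Lemma vol_ge0 B : 0 <= vol B. Proof. exact: volv_ge0. Qed.

Lemma vol0 : vol finset.set0 = 1. Proof. by rewrite /vol enum_set0. Qed.

Lemma volU1 B i : i \notin B -> vol (i |: B) = vol B * resid B i.
Proof.
move=> iB; rewrite /vol (@perm_volv _ _ (rcons (enum B) i)) ?volv_rcons ?add0v //.
apply: uniq_perm; rewrite ?rcons_uniq ?enum_uniq ?mem_enum ?iB // => j.
by rewrite mem_rcons in_cons !mem_enum !inE.
Qed.

Lemma volD1 B j : j \in B -> vol B = vol (B :\ j) * resid (B :\ j) j.
Proof. by move=> jB; rewrite -{1}(finset.setD1K jB) volU1 // finset.setD11. Qed.

Lemma resid_sub B B' i : B \subset B' -> resid B' i <= resid B i.
Proof. by move=> BB'; apply/dist2_sub/col_span_sub. Qed.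

Lemma resid_mem B i : i \in B -> resid B i = 0.
Proof. by move=> iB; apply/dist2_mem/mem_col_span. Qed.

Lemma rank_cols_le (X : 'M[R]_(d, n)) (s : seq 'cV[R]_d) :
  (forall j, col j X \in << s >>%VS) -> (\rank X <= size s)%N.
Proof.
move=> Xs; pose C := \matrix_(i < d, l < size s) s`_l i 0.
pose Z := \matrix_(l < size s, j < n) coord (in_tuple s) l (col j X).
suff -> : X = C *m Z by apply: leq_trans (mxrankM_maxl _ _) (rank_leq_col _).
apply/matrixP => i j; have /(congr1 (fun v : 'cV_d => v i 0)) :=
  @coord_span _ _ _ (in_tuple s) _ (Xs j).
rewrite !mxE => ->; rewrite summxE; apply: eq_bigr => l _.
by rewrite !mxE mulrC.
Qed.

(** The factorial is squared because [vol] is a squared volume. The last clause handles degenerate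
    sets: the greedy choice meets a zero residual only when the span already contains all columns of
    [T]. *)
Definition vol_greedy T B : Prop :=
  [/\ B \subset T,
      forall B', B' \subset T -> #|B'| = #|B| -> vol B' <= ((#|B|)`!)%:R ^+ 2 * vol B
    & vol B = 0 -> forall i, i \in T -> resid B i = 0].

Lemma vol_greedy0 T : vol_greedy T finset.set0.
Proof.
split; rewrite ?finset.sub0set // ?vol0; last by move/eqP; rewrite oner_eq0.
by move=> B' _ /eqP; rewrite cards0 cards_eq0 => /eqP ->; rewrite vol0 fact0 expr1n mulr1.
Qed.

(* The columns of [T] are all within [resid B i] of the [#|B|]-dimensional span
   of [B], so any [#|B| + 1] of them contain one that is within
   [(#|B| + 1)^2 resid B i] of the others. *)
Lemma vol_greedyS T B i :
    vol_greedy T B -> i \in T -> i \notin B ->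
    (forall j, j \in T -> j \notin B -> resid B j <= resid B i) ->
  vol_greedy T (i |: B).
Proof.
case=> BT Bvol B0 iT iB imax; split.
- by rewrite finset.subUset finset.sub1set iT.
- move=> B' B'T; rewrite cardsU1 iB add1n volU1 // => cB'.
  pose X := \matrix_(r < d, j < n) (col j A - perp_proj (col_span A B) (col j A)) r 0.
  have colX j : col j X = col j A - perp_proj (col_span A B) (col j A).
    by apply/colP => r; rewrite !mxE.
  have rX : (\rank X <= #|B|)%N.
    rewrite -(size_image (fun j => col j A) B); apply: rank_cols_le => j.
    by rewrite colX; have [] := perp_projP (col_span A B) (col j A).
  have [||j jB'] := @exists_loo_le _ _ _ A X B' #|B| (resid B i) rX.
  + by rewrite cB'.
  + move=> j jB'; rewrite colX subKr -/(dist2 _ _).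
    have [jB|jB] := boolP (j \in B); first by rewrite resid_mem // dist2_ge0.
    by apply: imax => //; apply: (fintype.subsetP B'T).
  rewrite cB' -natr1 addrAC subrr add0r expr1n mulr1 natr1 => loo_j.
  rewrite (volD1 jB') factS natrM exprMn.
  have cB'j : #|B' :\ j| = #|B| by have := cardsD1 j B'; rewrite jB' cB' add1n => -[].
  have /Bvol/(_ cB'j) vB'j : B' :\ j \subset T.
    by rewrite (fintype.subset_trans _ B'T) ?finset.subD1set.
  apply: le_trans (ler_pM (vol_ge0 _) (dist2_ge0 _ _) vB'j loo_j) _.
  by rewrite mulrACA [_ ^+ 2 * _ ^+ 2]mulrC mulrACA.
move=> /eqP; rewrite volU1 // mulf_eq0 => /orP[/eqP/B0 r0|/eqP r0] j jT.
  by apply/eqP; rewrite eq_le dist2_ge0 andbT -(r0 j jT) resid_sub // finset.subsetUr.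
have [jB|jB] := boolP (j \in B); first by rewrite resid_mem // inE jB orbT.
apply/eqP; rewrite eq_le dist2_ge0 andbT -r0 (le_trans _ (imax j jT jB)) //.
by rewrite resid_sub // finset.subsetUr.
Qed.

Definition stable (eta : R) T B : Prop :=
  forall i j, i \in T -> i \notin B -> j \in B -> resid B i <= (1 + eta) * resid (B :\ j) j.

(** Over the common part [B :\ j], the exchange replaces the factor of [j] by the residual of [i],
    which is at least the residual of [i] over the larger set [B]. *)
Lemma vol_swap eta B i j : i \notin B -> j \in B ->
  (1 + eta) * resid (B :\ j) j <= resid B i -> (1 + eta) * vol B <= vol (i |: B :\ j).
Proof.
move=> iB jB ij; rewrite (volD1 jB) volU1 ?inE ?(negPf iB) ?andbF // mulrCA.
by rewrite ler_wpM2l ?vol_ge0 // (le_trans ij) // resid_sub // finset.subD1set.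
Qed.

(** Counting exchanges by multiplicative growth needs a positive initial volume. If the volume is
    zero, all residuals vanish and the set is stable at once. *)
Lemma vol_greedy_stable eta T B :
  0 <= eta -> vol_greedy T B -> stable eta T B \/ 0 < vol B.
Proof.
move=> eta0 [_ _ B0]; have [/B0 r0|v0] := eqVneq (vol B) 0.
  left=> i j iT _ _; rewrite r0 // mulr_ge0 ?dist2_ge0 //.
  by rewrite addr_ge0.
by right; rewrite lt_def v0 vol_ge0.
Qed.

(** The cube of [n] exchanges would overshoot the gap between a greedy set and the maximum. By
    Bernoulli [(1 + eta) ^+ n] is at least 3, while the squared factorial is at most [(n * n) ^ n],
    which is below [(3 ^ n) ^ n]. *)
Lemma fact_lt_growth (eta : R) b : 0 <= eta -> (0 < n)%N -> (b <= n)%N ->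
  2 <= eta * n%:R -> (b`!)%:R ^+ 2 < (1 + eta) ^+ (n * (n * n)).
Proof.
move=> eta0 n0 bn etan.
have bern m : 1 + eta * m%:R <= (1 + eta) ^+ m.
  elim: m => [|m IHm]; first by rewrite mulr0 addr0 expr0.
  have e1 : 0 <= 1 + eta by lra.
  rewrite exprS; apply: le_trans (ler_wpM2l e1 IHm).
  have : 0 <= m%:R :> R by []. 
  by rewrite -natr1; nra.
have p3 : 3 <= (1 + eta) ^+ n by apply: le_trans (bern n); lra.
have fb m : (m`! <= m ^ m)%N.
  elim: m => // m IHm; rewrite factS expnS leq_mul2l /=.
  by case: m IHm => // m IHm; rewrite (leq_trans IHm) // leq_exp2r.
have n3 : (n * n < 3 ^ n)%N.
  elim: (n) => [|[|[|m]] IHm] //; rewrite expnS; nia.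
have : (b`! ^ 2 < 3 ^ (n * n))%N.
  apply: (@leq_ltn_trans ((n ^ n) ^ 2)%N); last by rewrite -expnM mulnC !expnM ltn_exp2r.
  rewrite leq_exp2r // (leq_trans _ (fb n)) // leq_fact //.
rewrite -(ltr_nat R) !natrX => /lt_le_trans; apply.
by rewrite [leRHS]exprM; apply: lerXn2r; rewrite ?nnegrE //; lra.
Qed.

(** The leave-one-out estimate for [B :&: J] gives a column of [B] that is close to the span of the
    rest of [B]; stability carries this bound over to all columns of [T] outside [B]. *)
Lemma block_price (eta kappa : R) (X : 'M[R]_(d, n)) T B J k v :
    0 <= eta -> 0 < kappa < 1 -> (\rank X <= k)%N -> stable eta T B ->
    (0 < #|B :&: J|)%N -> k%:R <= kappa * #|B :&: J|%:R ->
    (forall j, j \in J -> dotv (col j A - col j X) (col j A - col j X) < v) ->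
  forall i, i \in T -> i \notin B -> resid B i * (1 - kappa) ^+ 2 < (1 + eta) * v.
Proof.
move=> eta0 /andP[kappa0 kappa1] Xk Bst U0 kU Jv i iT iB.
have U0' : 0 < #|B :&: J|%:R :> R by rewrite ltr0n.
have /card_gt0P[j0 j0U] := U0.
pose o j := dotv (col j A - col j X) (col j A - col j X).
(* Using the largest error on [B :&: J] in place of [v] keeps the final inequality strict. *)
case: (@arg_maxP _ _ _ j0 (mem (B :&: J)) o j0U) => j1 j1U jmax.
have kU' : (k < #|B :&: J|)%N by rewrite -(ltr_nat R); nra.
have [j jU loo_j] := exists_loo_le Xk kU' jmax.
have [jB jJ] : j \in B /\ j \in J by move: jU; rewrite inE => /andP.
have j1J : j1 \in J by have : j1 \in B :&: J := j1U; rewrite inE => /andP[].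
have loo_j' : resid (B :\ j) j * (1 - kappa) ^+ 2 <= o j1.
  have : resid (B :\ j) j * (#|B :&: J|%:R * (1 - kappa)) ^+ 2
      <= #|B :&: J|%:R ^+ 2 * o j1.
    apply: le_trans loo_j.
    apply: ler_pM; rewrite ?dist2_ge0 ?sqr_ge0 //.
      by apply: resid_sub; apply: finset.setSD; apply: finset.subsetIl.
    by apply: lerXn2r; rewrite ?nnegrE; nra.
  by rewrite exprMn mulrCA ler_pM2l // exprn_gt0.
apply: le_lt_trans (_ : (1 + eta) * o j1 < _); last first.
  by rewrite ltr_pM2l ?Jv //; lra.
apply: le_trans (ler_wpM2r (sqr_ge0 _) (Bst i j iT iB jB)) _.
by rewrite -mulrA ler_wpM2l //; lra.
Qed.

End Volume.

(** * Charging prices to optimal costs *)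

Section Charging.
Variable R : realType.

(** Both sums are integrals over [v] of the number of values that are at least [v]. The induction
    cuts off the lowest layer, whose height is the least positive value of [a] on [P]; the index
    attaining it then stops being positive. *)
Lemma layer_cake (I : finType) (P Q : {set I}) (a e : I -> R) (c : R) :
    0 <= c -> (forall j, 0 <= e j) ->
    (forall v, 0 < v ->
       c * #|[set i in P | v <= a i]|%:R <= #|[set j in Q | v <= e j]|%:R) ->
  c * \sum_(i in P) a i <= \sum_(j in Q) e j.
Proof.
move=> c0; have [N] := ubnP #|[set i in P | 0 < a i]|.
elim: N P a e => // N IHN P a e; rewrite ltnS => aN e0 ace.
set P' := [set i in P | 0 < a i] in aN.
have sumP : \sum_(i in P) a i <= \sum_(i in P') a i.
  rewrite (bigID (fun i => 0 < a i)) /= -[leRHS]addr0 lerD //.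
    by rewrite le_eqVlt; apply/orP; left; apply/eqP/eq_bigl => i; rewrite inE.
  by apply: sumr_le0 => i /andP[_]; rewrite -leNgt.
apply: le_trans (ler_wpM2l c0 sumP) _.
have [P'0|[i0 i0P']] := set_0Vmem P'.
  by rewrite P'0 big_set0 mulr0 sumr_ge0.
case: (@arg_minP _ _ _ i0 (mem P') a i0P') => i1 i1P' imin.
set v := a i1 in imin; have v0 : 0 < v by move: (i1P' : i1 \in P'); rewrite inE => /andP[].
pose a' i := a i - v; pose e' j : R := Num.max (e j - v) 0.
have IH : c * \sum_(i in P') a' i <= \sum_(j in Q) e' j.
  apply: IHN => [||v' v'0].
  - apply: leq_trans aN; apply: proper_card; apply/properP; split.
      by apply/fintype.subsetP => i; rewrite !inE => /andP[].
    by exists i1; rewrite // !inE /a' subrr ltxx andbF.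
  - by move=> j; rewrite le_max lexx orbT.
  - have -> : [set i in P' | v' <= a' i] = [set i in P | v + v' <= a i].
      apply/setP => i; rewrite !inE /a' lerBrDl -andbA; congr (_ && _).
      by apply/andb_idl => /(lt_le_trans _) -> //; rewrite addr_gt0.
    have -> : [set j in Q | v' <= e' j] = [set j in Q | v + v' <= e j].
      by apply/setP => j; rewrite !inE /e' le_max lerBrDl [v' <= 0]leNgt v'0 orbF.
    by apply: ace; rewrite addr_gt0.
have cv := ace v v0.
(* By minimality of [v] the whole of [P'] reaches the top of the layer, so the hypothesis at
   threshold [v] bounds the contribution of the layer. *)
have P'v : P' = [set i in P | v <= a i].
  apply/setP => i; rewrite !inE; case iP: (i \in P) => //=.
  apply/idP/idP => [ai|]; last exact: lt_le_trans.
  have iP' : i \in P' by rewrite inE iP.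
  exact: imin.
have -> : \sum_(i in P') a i = \sum_(i in P') a' i + v * #|P'|%:R.
  by rewrite mulr_natr -sumr_const -big_split /=; apply: eq_bigr => i _; rewrite subrK.
have le_e : \sum_(j in Q) e' j + v * #|[set j in Q | v <= e j]|%:R <= \sum_(j in Q) e j.
  have -> : v * #|[set j in Q | v <= e j]|%:R = \sum_(j in Q) (if v <= e j then v else 0).
    by rewrite mulr_natr -sumr_const -big_mkcondr; apply: eq_bigl => j; rewrite inE.
  rewrite -big_split; apply: ler_sum => j _ /=; rewrite /e'.
  by have [ve|ve] := lerP v (e j); have [|] := lerP (e j - v) 0; have := e0 j; lra.
move: IH cv le_e; rewrite -P'v mulrDr; set x := c * \sum_(i in P') a' i.
have := v0; nra.
Qed.

End Charging.

(** * Blocks within a round, and the charging invariant over the rounds *)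

Section Rounds.
Variables (R : realType) (d n : nat) (A : 'M[R]_(d, n)) (k : nat) (eta kappa : R).
Hypotheses (eta_ge0 : 0 <= eta) (kappa_gt0 : 0 < kappa) (kappa_le : 16 * kappa <= 1).
Implicit Types (B T S G J I Bb Tb : {set 'I_n}) (b u l p m : nat).
Implicit Types (X : 'M[R]_(d, n)) (pi : 'I_n -> R).

Local Notation resid B i := (dist2 (col_span A B) (col i A)).
Let kappa01 : 0 < kappa < 1.
Proof. by have := kappa_le; rewrite kappa_gt0; lra. Qed.

Let eta1_gt0 : 0 < 1 + eta.
Proof. by have := eta_ge0; lra. Qed.

Definition err X j : R := dotv (col j A - col j X) (col j A - col j X).

Lemma err_ge0 X j : 0 <= err X j. Proof. exact: dotvv_ge0. Qed.

(** The state after [l] blocks: [T'] is what remains of [T], [Bb] the best block, [Tb] what remained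
    right after it and [nu] its price. The last clause prepares the pigeonhole argument: unless the
    price is already bounded in terms of [v], each block has taken at most [u.-1] columns of [J]. *)
Definition block_inv T b u l T' Bb Tb (nu : R) : Prop :=
  [/\ T' \subset T,
      #|T'| = (#|T| - l * b)%N,
      (0 < l)%N -> [/\ #|Bb| = b, Tb \subset T, (#|T| - l * b <= #|Tb|)%N
                     & forall i, i \in Tb -> resid Bb i <= nu]
    & forall X (v : R) J, (\rank X <= k)%N -> J \subset T ->
        (forall j, j \in J -> err X j < v) ->
        (#|J| <= #|J :&: T'| + l * u.-1)%N \/
        (0 < l)%N /\ nu * (1 - kappa) ^+ 2 < (1 + eta) * v].

Lemma block_inv0 T b u Bb Tb nu : block_inv T b u 0 T Bb Tb nu.
Proof.
split; rewrite ?subn0 // => X v J _ JT _; left.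
by rewrite addn0 (finset.setIidPl JT).
Qed.

Lemma block_invS T b u l T' Bb Tb nu B (nuB : R) :
    block_inv T b u l T' Bb Tb nu ->
    (0 < u)%N -> k%:R <= kappa * u%:R -> (l.+1 * b <= #|T|)%N ->
    B \subset T' -> #|B| = b -> stable A eta T' B ->
    (forall i, i \in T' -> i \notin B -> resid B i <= nuB) ->
    nuB = 0 \/ (exists2 i, i \in T' :\: B & nuB = resid B i) ->
  let better := (l == 0)%N || (nuB < nu) in
  block_inv T b u l.+1 (T' :\: B) (if better then B else Bb)
    (if better then T' :\: B else Tb) (if better then nuB else nu).
Proof.
case=> T'T cT' best low u0 ku lbT BT' cB Bst Bnu nuBE better.
have cT'B : #|T' :\: B| = (#|T| - l.+1 * b)%N.
  by rewrite cardsD (finset.setIidPr BT') cT' cB mulSn addnC subnDA.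
have D_T : T' :\: B \subset T by rewrite (fintype.subset_trans _ T'T) ?finset.subsetDl.
split=> // [_|X v J rX JT Jv].
  rewrite /better; case: (l =P 0%N) => [_|/eqP l0] /=; last case: ifP => _.
  - by split=> //; rewrite ?cT'B // => i; rewrite inE => /andP[iB iT]; apply: Bnu.
  - by split=> //; rewrite ?cT'B // => i; rewrite inE => /andP[iB iT]; apply: Bnu.
  - have [|cBb TbT cTb Tbnu] := best; first by rewrite lt0n.
    by split=> //; apply: leq_trans cTb; rewrite leq_sub2l // mulSn leq_addl.
have cJ : (#|J :&: T'| = #|J :&: (T' :\: B)| + #|B :&: J|)%N.
  rewrite -(cardsID B (J :&: T')) addnC finset.setIDA; congr (_ + #|pred_of_set _|)%N.
  by rewrite -finset.setIA (finset.setIidPr BT') finset.setIC.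
(* Either the new block holds at least [u] columns of [J] and [block_price] applies, or it costs [J]
   at most [u.-1] columns. *)
have [uJ|uJ] := leqP u #|B :&: J|; last first.
  have [JT'|[l0 nuv]] := low X v J rX JT Jv.
    by left; apply: leq_trans JT' _; rewrite cJ mulSn -addnA leq_add2l leq_add2r -ltnS prednK.
  right; split=> //; rewrite /better; case: ifP => // /orP[/eqP l00|/ltW nule].
    by rewrite l00 in l0.
  by apply: le_lt_trans nuv; rewrite ler_wpM2r ?sqr_ge0.
right; split=> //.
have BJ0 : (0 < #|B :&: J|)%N := leq_trans u0 uJ.
have kBJ : k%:R <= kappa * #|B :&: J|%:R.
  by apply: le_trans ku _; rewrite ler_pM2l // ler_nat.
have nuBv : nuB * (1 - kappa) ^+ 2 < (1 + eta) * v.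
  case: nuBE => [->|[i]]; last first.
    rewrite inE => /andP[iB iT] ->.
    exact: (block_price eta_ge0 kappa01 rX Bst BJ0 kBJ Jv iT iB).
  (* The case [nuB = 0], which includes the case that no column is left. The strict bound then needs
     [v] positive, and [v] exceeds the error of a column of [J]. *)
  have /card_gt0P[j] := BJ0; rewrite inE => /andP[_ /Jv jv].
  by rewrite mul0r mulr_gt0 // (le_lt_trans (err_ge0 X j)).
rewrite /better; case: ifP => // /norP[_]; rewrite -leNgt => nule.
by apply: le_lt_trans nuBv; rewrite ler_wpM2r ?sqr_ge0.
Qed.

(** If every block took at most [u.-1] columns of [J], at least [2 * (p * u) - p * u.-1], that is
    [p * u + p], of them would remain, more than there are columns left. *)
Lemma block_inv_end T b u p T' Bb Tb nu X v J :
    block_inv T b u p T' Bb Tb nu -> (0 < p)%N -> (0 < u)%N ->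
    (#|T| - p * b < p * u + p)%N ->
    (\rank X <= k)%N -> J \subset T -> (2 * (p * u) <= #|J|)%N ->
    (forall j, j \in J -> err X j < v) ->
  nu * (1 - kappa) ^+ 2 < (1 + eta) * v.
Proof.
case=> _ cT' _ low p0 u0 lft rX JT cJ Jv.
have [JT'|[]//] := low X v J rX JT Jv.
have := subset_leq_card (finset.subsetIr J T'); rewrite cT' => JT''.
have : (p * u.-1 + p = p * u)%N by rewrite -mulnSr prednK.
nia.
Qed.

(* Charging invariant: [T] is the set of columns not yet placed in [B'], [S] the
   columns chosen so far and [pi i] an upper bound for the cost of column [i]. *)
Definition charged m T S pi : Prop :=
  (forall i, i \notin T -> resid S i <= pi i) /\
  forall X I (v : R), (\rank X <= k)%N -> (#|~: I| <= m)%N -> 0 < v ->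
    (forall i, i \notin T -> pi i * (1 - kappa) ^+ 2 < (1 + eta) * v) \/
    (1 - 2 * kappa) * (#|[set i in ~: T | (1 + eta) * v <= pi i * (1 - kappa) ^+ 2]|%:R
                       + (#|T| - m)%:R)
      <= #|[set j in I | v <= err X j]|%:R.

Lemma charged0 m : charged m [set: 'I_n] finset.set0 (fun=> 0).
Proof.
split=> [i|X I v _ _ v0]; first by rewrite inE.
by left=> i; rewrite inE.
Qed.

(** Write [x] for [#|T| - m]. If the new price stays below the threshold, the count does not grow
    and [x] only shrinks. Otherwise [G] adds at most [#|G|] to the count, which is offset by the
    decrease of [x]. The first time this happens the count is still zero; then fewer than [2 * #|G|]
    inliers in [T] are cheaper than [v], so at least [x - 2 * #|G|] inliers cost [v] or more, which
    covers [(1 - 2 * kappa) * x]. *)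
Lemma charged_round m T S pi Bb Tb G (nu : R) :
    charged m T S pi -> Tb \subset T -> G \subset Tb ->
    (forall i, i \in Tb -> resid Bb i <= nu) ->
    #|G|%:R <= kappa * (#|T| - m)%:R ->
    (forall X (v : R) J, (\rank X <= k)%N -> J \subset T -> (2 * #|G| <= #|J|)%N ->
       (forall j, j \in J -> err X j < v) -> nu * (1 - kappa) ^+ 2 < (1 + eta) * v) ->
  charged m (T :\: G) (S :|: Bb) (fun i => if i \in G then nu else pi i).
Proof.
have [k0 k16 e0] := And3 kappa_gt0 kappa_le eta_ge0.
case=> cost charge TbT GTb Tbnu Gx low; split=> [i|X I v rX cI v0].
  rewrite inE negb_and negbK; case: ifP => [iG _|iG /= iT].
    apply: le_trans (resid_sub A i (finset.subsetUr S Bb)) _.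
    by apply: Tbnu; apply: (fintype.subsetP GTb).
  exact: le_trans (resid_sub A i (finset.subsetUl S Bb)) (cost i iT).
have GT : G \subset T := fintype.subset_trans GTb TbT.
have cG : (#|G| <= #|T| - m)%N.
  rewrite -(ler_nat R); apply: le_trans Gx _.
  by rewrite ler_piMl //; lra.
have cTG : (#|T :\: G| - m = #|T| - m - #|G|)%N.
  by rewrite cardsD (finset.setIidPr GT) subnAC.
have [nuv|vnu] := ltP (nu * (1 - kappa) ^+ 2) ((1 + eta) * v).
  have [all_lt|many] := charge X I v rX cI v0; [left|right].
    by move=> i; rewrite inE negb_and negbK; case: ifP => [//|_ /= /all_lt].
  apply: le_trans many; apply: ler_wpM2l; first by lra.
  apply: lerD; rewrite ler_nat; last by rewrite cTG leq_subr.
  apply: subset_leq_card; apply/fintype.subsetP => i; rewrite !inE.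
  case: ifP => [_ /andP[_]|_ /=]; first by rewrite leNgt nuv.
  by rewrite andbC.
right; pose J := [set j in I :&: T | err X j < v].
have JT : J \subset T by apply/fintype.subsetP => j; rewrite !inE => /andP[/andP[]].
have cJ : (#|J| < 2 * #|G|)%N.
  rewrite ltnNge; apply/negP => /(low X v J rX JT); rewrite ltNge vnu => /(_ _)/negP.
  by apply=> // j; rewrite !inE => /andP[].
set F := [set j in I | v <= err X j].
have xF : (#|T| - m <= #|F| + 2 * #|G|)%N.
  have ITF : (#|T :&: I| <= #|F| + #|J|)%N.
    rewrite -(cardsID [set j | err X j < v]) addnC leq_add //.
      apply: subset_leq_card; apply/fintype.subsetP => j.
      by rewrite !inE -leNgt => /andP[-> /andP[_ ->]].
    apply: subset_leq_card; apply/fintype.subsetP => j.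
    by rewrite !inE andbC => /andP[-> /andP[-> ->]].
  have TI : (#|T :\: I| <= m)%N.
    by apply: leq_trans cI; apply: subset_leq_card; rewrite finset.setDE finset.subsetIr.
  have := cardsID I T.
  by move: ITF TI cJ; clear; lia.
have FR : (#|T| - m)%:R <= #|F|%:R + 2 * #|G|%:R :> R.
  by rewrite -natrM -natrD ler_nat.
set N' := #|[set i in ~: (T :\: G) | _]|.
set N := #|[set i in ~: T | (1 + eta) * v <= pi i * (1 - kappa) ^+ 2]|.
have NN' : (N' <= N + #|G|)%N.
  rewrite /N' /N; apply: leq_trans (leq_card_setU _ _).
  apply: subset_leq_card; apply/fintype.subsetP => i; rewrite !inE.
  by case: (i \in G) => /=; rewrite ?orbT ?orbF // andbC.
have x'R : (#|T :\: G| - m)%:R = (#|T| - m)%:R - #|G|%:R :> R by rewrite cTG natrB.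
have NN'R : N'%:R <= N%:R + #|G|%:R :> R by rewrite -natrD ler_nat.
have k12 : 0 <= 1 - 2 * kappa by lra.
have [all_lt|many] := charge X I v rX cI v0.
  have N0 : N = 0%N.
    apply: eq_card0 => i; rewrite !inE; apply/negbTE/negP => /andP[/all_lt].
    by rewrite ltNge => /negbTE ->.
  rewrite x'R; apply: (@le_trans _ _ ((1 - 2 * kappa) * (#|T| - m)%:R)).
    by apply: ler_wpM2l => //; rewrite N0 in NN'R; lra.
  by rewrite mulrBl mul1r; lra.
apply: le_trans many; apply: ler_wpM2l => //; rewrite x'R; lra.
Qed.

(** The columns of [T] join the chosen set, so their residuals vanish and the price zero is enough
    for them. *)
Lemma charged_finish m T S pi : charged m T S pi ->
  charged m finset.set0 (S :|: T) (fun i => if i \in T then 0 else pi i).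
Proof.
have [k0 k16 e0] := And3 kappa_gt0 kappa_le eta_ge0.
case=> cost charge; split=> [i _|X I v rX cI v0].
  case: ifP => iT; first by rewrite resid_mem // inE iT orbT.
  apply: le_trans (resid_sub A i (finset.subsetUl S T)) (cost i _).
  by rewrite iT.
have v1 : 0 < (1 + eta) * v by rewrite mulr_gt0.
have [all_lt|many] := charge X I v rX cI v0; [left=> i _|right].
  by case: ifP => [_|/negbT/all_lt //]; rewrite mul0r.
apply: le_trans many; apply: ler_wpM2l; first by lra.
apply: lerD; rewrite ler_nat ?cards0 ?sub0n //.
apply: subset_leq_card; apply/fintype.subsetP => i; rewrite !inE.
by case: ifP => //= _; rewrite mul0r leNgt v1.
Qed.

(** The invariant is the threshold hypothesis of [layer_cake] for the prices rescaled by
    [(1 - kappa) ^+ 2 / (1 + eta)], once the nonnegative reserve [#|T| - m] is dropped. *)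
Lemma charged_sum m T S pi X I :
    charged m T S pi -> (\rank X <= k)%N -> (#|~: I| <= m)%N ->
  (1 - 2 * kappa) * (1 - kappa) ^+ 2 * \sum_(i in ~: T) resid S i
    <= (1 + eta) * \sum_(j in I) err X j.
Proof.
have [k0 k16 e0] := And3 kappa_gt0 kappa_le eta_ge0.
case=> cost charge rX cI.
have k2 : 0 < (1 - kappa) ^+ 2 by rewrite exprn_gt0 //; lra.
have le_pi : \sum_(i in ~: T) resid S i <= \sum_(i in ~: T) pi i.
  by apply: ler_sum => i; rewrite inE => /cost.
apply: le_trans (_ : (1 - 2 * kappa) * (1 - kappa) ^+ 2 * \sum_(i in ~: T) pi i <= _).
  by apply: ler_wpM2l le_pi; apply: mulr_ge0; rewrite ?ltW //; lra.
have := @layer_cake R _ (~: T) I (fun i => pi i * (1 - kappa) ^+ 2 / (1 + eta)) (err X)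
  (1 - 2 * kappa).
rewrite -mulr_suml -mulr_suml => H.
rewrite mulrC -ler_pdivrMl // mulrC.
apply: le_trans (H _ _ _); rewrite ?(mulrC (1 + eta)^-1) //.
- by rewrite le_eqVlt; apply/orP; left; apply/eqP; ring.
- by lra.
- exact: err_ge0.
move=> v v0.
have setE : [set i in ~: T | v <= pi i * (1 - kappa) ^+ 2 / (1 + eta)]
    = [set i in ~: T | (1 + eta) * v <= pi i * (1 - kappa) ^+ 2].
  by apply/setP => i; rewrite !inE ler_pdivlMr // mulrC.
rewrite setE; have [all_lt|many] := charge X I v rX cI v0.
  rewrite (eq_card0 (_ : _ =i pred0)) ?mulr0 // => i; rewrite !inE.
  by apply/negbTE/negP => /andP[/all_lt]; rewrite ltNge => /negbTE ->.
by apply: le_trans many; apply: ler_wpM2l; [lra|rewrite lerDl].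
Qed.

End Rounds.

(** * The size of the chosen set *)

Section SizePotential.
Variable R : realType.
Implicit Types (m x y g kappa delta : R).

(** Its derivative in [x] is [(1 + m / x) / x]. Lowering [x] by a fixed fraction therefore releases
    a multiple of [1 + m / x], the order of growth of a block. *)
Definition psi m x : R := ln x - m / x.

Lemma ln_le_subr1 x : 0 < x -> ln x <= x - 1.
Proof. by move=> x0; have := @le_ln1Dx R (x - 1); rewrite (addrC 1) subrK; apply; lra. Qed.

(** The logarithm drops by at least [g / x], and [m / x] rises by [g / y * (m / x)] with
    [y = x - g]; both fractions [g / x] and [g / y] are at least [kappa / 2]. *)
Lemma psi_step m x g kappa : 0 <= m -> 0 < x -> 0 < kappa -> kappa * x <= 2 * g ->
  g < x -> 1 + m / x <= 2 / kappa * (psi m x - psi m (x - g)).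
Proof.
move=> m0 x0 k0 kg gx; set y := x - g; have y0 : 0 < y by rewrite /y; lra.
have yx0 : 0 < y / x by rewrite divr_gt0.
have lnxy : g / x <= ln x - ln y.
  have := ln_le_subr1 yx0; rewrite ln_div ?posrE // => h.
  have -> : g / x = 1 - y / x by rewrite /y; field; lra.
  by lra.
have gk : kappa / 2 <= g / x by rewrite ler_pdivlMr //; lra.
have mxy : kappa / 2 * (m / x) <= m / y - m / x.
  have -> : m / y - m / x = g / y * (m / x).
    by rewrite /y; field; apply/andP; split; lra.
  apply: ler_wpM2r; first by rewrite divr_ge0 // ltW.
  apply: le_trans gk _; rewrite ler_pM2l ?lef_pV2 ?posrE //; first by rewrite /y; nra.
  by nra.
have : kappa / 2 * (1 + m / x) <= psi m x - psi m y.
  by rewrite mulrDr mulr1 /psi; lra.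
move=> h; have -> : 1 + m / x = 2 / kappa * (kappa / 2 * (1 + m / x)).
  by rewrite mulrA; have -> : 2 / kappa * (kappa / 2) = 1 by [field; lra]; rewrite mul1r.
by apply: ler_wpM2l h; rewrite divr_ge0 // ltW.
Qed.

(** The factor 8 collects three factors 2: from [p + 1 <= 2 p], from [u <= 2 k / kappa], and from
    [psi_step]. *)
Lemma block_size_le m x kappa (k u p b : nat) :
    0 <= m -> 0 < x -> 0 < kappa -> kappa <= 1 -> (0 < k)%N -> (0 < p)%N -> (0 < u)%N ->
    u%:R <= k%:R / kappa + 1 -> p%:R * u%:R <= kappa * x -> p%:R * u%:R < x ->
    kappa * x < (p%:R + 1) * u%:R -> b%:R * p%:R <= x + m ->
  b%:R <= 8 * k%:R / kappa ^+ 3 * (psi m x - psi m (x - p%:R * u%:R)).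
Proof.
move=> m0 x0 k0 k1 kk pp uu uk pu pux pux1 bp.
have p1 : 1 <= p%:R :> R by rewrite ler1n.
have kk1 : 1 <= k%:R :> R by rewrite ler1n.
have u1 : 1 <= u%:R :> R by rewrite ler1n.
have gk : kappa * x <= 2 * (p%:R * u%:R) by nra.
have := psi_step m0 x0 k0 gk pux; set D := psi m x - _ => step.
have u2 : u%:R <= 2 * k%:R / kappa.
  have : 1 <= k%:R / kappa by rewrite ler_pdivlMr // mul1r (le_trans k1).
  by rewrite -mulrA; lra.
have bx : b%:R * (kappa * x) <= 2 * u%:R * (x + m) by nra.
have bR : b%:R <= 2 * u%:R / kappa * (1 + m / x).
  have -> : 2 * u%:R / kappa * (1 + m / x) = 2 * u%:R * (x + m) / (kappa * x).
    by field; apply/andP; split; lra.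
  by rewrite ler_pdivlMr ?mulr_gt0.
apply: le_trans bR _; apply: (@le_trans _ _ (4 * k%:R / kappa ^+ 2 * (1 + m / x))).
  apply: ler_wpM2r; first by rewrite addr_ge0 ?divr_ge0 // ltW.
  have -> : 4 * k%:R / kappa ^+ 2 = 2 * (2 * k%:R / kappa) / kappa by field; lra.
  by rewrite ler_pM2r ?invr_gt0 // ler_pM2l.
have -> : 8 * k%:R / kappa ^+ 3 * D = 4 * k%:R / kappa ^+ 2 * (2 / kappa * D) by field; lra.
by apply: ler_wpM2l step; rewrite divr_ge0 ?sqr_ge0 //; lra.
Qed.

(** The lower bound on [x] gives [m / x <= 2 / delta], and [ln m - ln x] is at most [m / x - 1]. So
    the difference is at most [ln (n / m)] plus twice [2 / delta]. *)
Lemma psi_total m n x delta : 0 < m -> 0 < delta -> delta <= 1 -> m < n ->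
  delta * m <= 2 * x -> x <= n -> psi m (n - m) - psi m x <= 2 * (ln (n / m) + 2 / delta).
Proof.
move=> m0 d0 d1 mn dx xn; have x0 : 0 < x by nra.
have nm0 : 0 < n - m by lra.
have lnnm : ln (n - m) <= ln n by rewrite ler_ln ?posrE //; lra.
have lnn : ln n = ln (n / m) + ln m by rewrite ln_div ?posrE //; lra.
have lnx : ln m - ln x <= 2 / delta.
  rewrite -ln_div ?posrE // (le_trans (ln_le_subr1 _)) ?divr_gt0 //.
  have : m / x <= 2 / delta by rewrite ler_pdivrMr // mulrAC ler_pdivlMr //; lra.
  by lra.
have mx : m / x <= 2 / delta by rewrite ler_pdivrMr // mulrAC ler_pdivlMr //; lra.
have mnm : 0 <= m / (n - m) by rewrite divr_ge0 ?ltW.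
have : 0 <= ln (n / m) by apply: ln_ge0; rewrite ler_pdivlMr //; lra.
by rewrite /psi; lra.
Qed.

(** Here [x + m] is the number of columns active when [u] is too large for another round. It is at
    most [x * (2 / delta)], and [x <= u / kappa <= 2 k / kappa ^+ 2]. *)
Lemma last_size_le m x kappa delta (k u : nat) :
    0 < m -> 0 < kappa -> kappa <= 1 -> 0 < delta -> delta <= 1 -> (0 < k)%N ->
    u%:R <= k%:R / kappa + 1 -> kappa * x <= u%:R -> delta * m <= x ->
  x + m <= 2 * k%:R / kappa ^+ 3 * (2 / delta).
Proof.
move=> m0 k0 k1 d0 d1 kk uk xu dx.
have kk1 : 1 <= k%:R :> R by rewrite ler1n.
have x0 : 0 < x by nra.
have xm : x + m <= x * (2 / delta).
  by rewrite mulrA ler_pdivlMr //; nra.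
apply: le_trans xm _; apply: ler_wpM2r; first by rewrite divr_ge0 ?ltW.
rewrite ler_pdivlMr ?exprn_gt0 //.
have ukk : u%:R * kappa <= 2 * k%:R.
  have := ler_wpM2r (ltW k0) uk; rewrite mulrDl divfK ?gt_eqF // mul1r; lra.
have : x * kappa ^+ 2 <= u%:R * kappa.
  by rewrite expr2 mulrA ler_pM2r // mulrC.
have : x * kappa ^+ 3 <= x * kappa ^+ 2.
  by rewrite ler_pM2l // exprSr ler_piMr // sqr_ge0.
lra.
Qed.

(** The construction needs only the third power of [1 / eps]; as [eps <= 1], this is below the sixth
    power. The condition [m <= n] makes the logarithm nonnegative, so that [Num.max] is harmless. *)
Lemma size_le_budget (n m k : nat) (eps delta y : R) :
    0 < eps -> eps <= 1 -> 0 < delta -> (0 < m)%N -> (m <= n)%N ->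
    y <= 18 * k%:R / (eps / 16) ^+ 3 * (ln (n%:R / m%:R) + 2 / delta) ->
  y <= 18 * 16 ^+ 3 * (k%:R / eps ^+ 6 * Num.max 0 (ln (n%:R / m%:R) + 2 / delta)).
Proof.
move=> e0 e1 d0 m0 mn; set L := ln _ + _ => yL.
have m0' : 0 < m%:R :> R by rewrite ltr0n.
have L0 : 0 <= L.
  apply: addr_ge0; last by rewrite divr_ge0 // ltW.
  by apply: ln_ge0; rewrite ler_pdivlMr // mul1r ler_nat.
rewrite max_r //; apply: le_trans yL _; rewrite mulrA; apply: ler_wpM2r => //.
have -> : 18 * k%:R / (eps / 16) ^+ 3 = 18 * 16 ^+ 3 * (k%:R / eps ^+ 3) by field; lra.
rewrite ler_pM2l // ler_wpM2l // lef_pV2 ?posrE ?exprn_gt0 //.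
by rewrite ler_wiXn2l // ltW.
Qed.

(** For [kappa = eps / 16] and [eta = eps / 8] the left side is [1 + eta], and the right side is
    [1 + eps] times the constant lost in [charged_sum]. *)
Lemma eps_budget kappa : 0 < kappa -> 16 * kappa <= 1 ->
  1 + 2 * kappa <= (1 + 16 * kappa) * ((1 - 2 * kappa) * (1 - kappa) ^+ 2).
Proof.
move=> k0 k1; have h : 1 - 4 * kappa <= (1 - 2 * kappa) * (1 - kappa) ^+ 2 by nra.
apply: (@le_trans _ _ ((1 + 16 * kappa) * (1 - 4 * kappa))); first by nra.
by apply: ler_wpM2l h; lra.
Qed.

End SizePotential.

(** * Programs with bounded loops *)

(* Loops run over [0 .. d-1] or [0 .. n-1] only, so that every program
   terminates within a number of steps polynomial in [d + n]. *)
Inductive prog : Type :=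
| PSkip
| PN of nat & nexp & nexp & nexp
| PR of nat & nexp & nexp & rexp
| PSeq of prog & prog
| PIf of bexp & prog & prog
| PFor of nat & nat & prog.

Definition scalar (x : nat) : nexp := NGet x (NLit 0) (NLit 0).

Fixpoint compile (p : prog) : cmd :=
  match p with
  | PSkip => Skip
  | PN x e1 e2 e => NSet x e1 e2 e
  | PR x e1 e2 e => RSet x e1 e2 e
  | PSeq p q => Seq (compile p) (compile q)
  | PIf b p q => If b (compile p) (compile q)
  | PFor N x p =>
      Seq (NSet x (NLit 0) (NLit 0) (NLit 0))
        (While (NLt (scalar x) (scalar N))
           (Seq (compile p) (NSet x (NLit 0) (NLit 0) (NAdd (scalar x) (NLit 1)))))
  end.

Fixpoint wnat (p : prog) : seq nat :=
  match p with
  | PSkip | PR _ _ _ _ => [::]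
  | PN x _ _ _ => [:: x]
  | PSeq p q | PIf _ p q => wnat p ++ wnat q
  | PFor _ x p => x :: wnat p
  end.

Fixpoint wreal (p : prog) : seq nat :=
  match p with
  | PSkip | PN _ _ _ _ => [::]
  | PR x _ _ _ => [:: x]
  | PSeq p q | PIf _ p q => wreal p ++ wreal q
  | PFor _ _ p => wreal p
  end.

(** Natural cells 0 and 1 hold the loop bounds [d] and [n]. They are never written, and a loop body
    never writes its own counter, so the number of iterations is fixed on entry. *)
Fixpoint wf (p : prog) : bool :=
  match p with
  | PSkip | PR _ _ _ _ => true
  | PN x _ _ _ => (1 < x)%N
  | PSeq p q | PIf _ p q => wf p && wf q
  | PFor N x p => [&& (N <= 1)%N, (1 < x)%N, x \notin wnat p & wf p]
  end.

Lemma wf_wnat p N : wf p -> (N <= 1)%N -> N \notin wnat p.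
Proof.
elim: p => //= [x _ _ _|p IHp q IHq|_ p IHp q IHq|M x p IHp] wfp N1.
- by rewrite inE; apply: contraL wfp => /eqP <-; rewrite -leqNgt.
- by case/andP: wfp => ? ?; rewrite mem_cat negb_or IHp ?IHq.
- by case/andP: wfp => ? ?; rewrite mem_cat negb_or IHp ?IHq.
case/and4P: wfp => _ x1 _ wfp; rewrite inE negb_or IHp // andbT.
by apply: contraL x1 => /eqP <-; rewrite -leqNgt.
Qed.

(** * Big-step execution, loop invariants and running time *)

Section Semantics.
Variable R : realType.
Implicit Types (s : state R) (p q : prog).

Definition setn s x v : state R := State (upd (nmem s) x 0 0 v) (rmem s).

Fixpoint exec p s : state R :=
  match p with
  | PSkip => s
  | PN x e1 e2 e =>
      State (upd (nmem s) x (neval s e1) (neval s e2) (neval s e)) (rmem s)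
  | PR x e1 e2 e =>
      State (nmem s) (upd (rmem s) x (neval s e1) (neval s e2) (reval s e))
  | PSeq p q => exec q (exec p s)
  | PIf b p q => if beval s b then exec p s else exec q s
  | PFor N x p =>
      iter (nmem s N 0%N 0%N)%N
        (fun s' => let s'' := exec p s' in setn s'' x (nmem s'' x 0%N 0%N).+1)%N (setn s x 0)
  end.

Definition same (wn wr : seq nat) s s' : Prop :=
  (forall y, y \notin wn -> forall i j, nmem s' y i j = nmem s y i j) /\
  (forall y, y \notin wr -> forall i j, rmem s' y i j = rmem s y i j).

Lemma upd_neq (T : Type) (f : memory T) x i j v y a b :
  y != x -> upd f x i j v y a b = f y a b.
Proof. by rewrite /upd => /negPf ->. Qed.

Lemma upd_eq (T : Type) (f : memory T) x i j v : upd f x i j v x i j = v.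
Proof. by rewrite /upd !eqxx. Qed.

Lemma sub_same wn wr wn' wr' s s' : {subset wn <= wn'} -> {subset wr <= wr'} ->
  same wn wr s s' -> same wn' wr' s s'.
Proof.
move=> wn_s wr_s [sn sr]; split=> y yw; [apply: sn|apply: sr].
  by apply: contra yw => /wn_s.
by apply: contra yw => /wr_s.
Qed.

Lemma same_trans wn wr s1 s2 s3 : same wn wr s1 s2 -> same wn wr s2 s3 -> same wn wr s1 s3.
Proof.
by move=> [n1 r1] [n2 r2]; split=> y yw i j; rewrite ?n2 ?n1 ?r2 ?r1.
Qed.

Lemma same_setn wn wr s x v : x \in wn -> same wn wr s (setn s x v).
Proof.
move=> xw; split=> // y yw i j; apply: upd_neq.
by apply: contraNneq yw => ->.
Qed.

Lemma exec_same p s : same (wnat p) (wreal p) s (exec p s).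
Proof.
elim: p s => [|x e1 e2 e|x e1 e2 e|p IHp q IHq|b p IHp q IHq|N x p IHp] s /=.
- by [].
- by split=> // y; rewrite inE => yx i j; apply: upd_neq.
- by split=> // y; rewrite inE => yx i j; apply: upd_neq.
- apply: (@same_trans _ _ _ (exec p s)).
    by apply: sub_same (IHp s) => y yp; rewrite mem_cat yp.
  by apply: sub_same (IHq _) => y yq; rewrite mem_cat yq orbT.
- case: ifP => _; first by apply: sub_same (IHp s) => y yp; rewrite mem_cat yp.
  by apply: sub_same (IHq _) => y yq; rewrite mem_cat yq orbT.
elim: (nmem s N 0%N 0%N) => [|k IHk] /=; first by apply: same_setn; rewrite mem_head.
apply: same_trans IHk _; apply: same_trans (same_setn _ _ _ _); last exact: mem_head.
by apply: sub_same (IHp _) => y yp //; rewrite inE yp orbT.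
Qed.

(** The invariant must tolerate any write to the counter, as the loop makes such writes between runs
    of the body. The [same] premise lets the body use facts about the initial state without listing
    them in [P]. *)
Lemma exec_for_inv N x p s (P : nat -> state R -> Prop) :
    N \notin x :: wnat p -> x \notin wnat p ->
    (forall j s' v, P j s' -> P j (setn s' x v)) ->
    P 0%N s ->
    (forall j s', (j < nmem s N 0%N 0%N)%N -> nmem s' x 0%N 0%N = j ->
       same (x :: wnat p) (wreal p) s s' -> P j s' -> P j.+1 (exec p s')) ->
  P (nmem s N 0%N 0%N) (exec (PFor N x p) s).
Proof.
move=> Nw xw Px P0 PS /=; set body := fun s' => _.
suff: forall j, (j <= nmem s N 0%N 0%N)%N -> let s' := iter j body (setn s x 0) in
    [/\ nmem s' x 0%N 0%N = j, same (x :: wnat p) (wreal p) s s' & P j s'].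
  by move=> /(_ _ (leqnn _))[].
elim=> [|j IHj] jN /=; first by split; [exact: upd_eq|apply: same_setn; exact: mem_head|exact: Px].
have [xj sj Pj] := IHj (ltnW jN); rewrite /body.
have [ep _] := exec_same p (iter j body (setn s x 0)).
have xp := ep _ xw 0%N 0%N.
split; first by rewrite upd_eq xp xj.
  apply: same_trans sj _; apply: same_trans (same_setn _ _ _ _); last exact: mem_head.
  by apply: sub_same (exec_same p _) => y yp //; rewrite inE yp orbT.
exact/Px/PS.
Qed.

(** For a loop, each iteration pays the test, the unfolding of the sequence and the increment
    besides its body; the leading 3 pays the outer sequence, the initialization and the last
    test. *)
Fixpoint cost p (D : nat) : nat :=
  match p with
  | PSkip | PN _ _ _ _ | PR _ _ _ _ => 1
  | PSeq p q | PIf _ p q => 1 + (cost p D + cost q D)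
  | PFor _ _ p => 3 + D * (3 + cost p D)
  end%N.

Lemma cost_poly p : exists c, forall D, (cost p D <= c * D.+1 ^ c)%N.
Proof.
have pos D c : (0 < D.+1 ^ c)%N by rewrite expn_gt0.
elim: p => [|x e1 e2 e|x e1 e2 e|p [c IHp] q [c' IHq]|b p [c IHp] q [c' IHq]|N x p [c IHp]] /=.
- by exists 1%N => D; rewrite mul1n.
- by exists 1%N => D; rewrite mul1n.
- by exists 1%N => D; rewrite mul1n.
- exists (1 + (c + c'))%N => D; rewrite mulnDl leq_add // ?mul1n //.
  rewrite mulnDl leq_add //; [apply: leq_trans (IHp D) _|apply: leq_trans (IHq D) _];
    by rewrite leq_mul // leq_pexp2l //; lia.
- exists (1 + (c + c'))%N => D; rewrite mulnDl leq_add // ?mul1n //.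
  rewrite mulnDl leq_add //; [apply: leq_trans (IHp D) _|apply: leq_trans (IHq D) _];
    by rewrite leq_mul // leq_pexp2l //; lia.
exists (6 + c)%N => D; have Dc := pos D c.
apply: (@leq_trans (3 + D * ((3 + c) * D.+1 ^ c))%N).
  rewrite leq_add2l leq_mul2l mulnDl leq_add ?orbT //.
  by rewrite leq_pmulr.
apply: (@leq_trans ((6 + c) * D.+1 ^ c.+1)%N); first by rewrite expnS; nia.
by rewrite leq_mul // leq_pexp2l //; lia.
Qed.

Lemma run_compile p s ks D : wf p -> (nmem s 0%N 0%N 0%N <= D)%N -> (nmem s 1%N 0%N 0%N <= D)%N ->
  exists2 t, (t <= cost p D)%N & iter t (@step R) (compile p :: ks, s) = (ks, exec p s).
Proof.
elim: p s ks => [|x e1 e2 e|x e1 e2 e|p IHp q IHq|b p IHp q IHq|N x p IHp] s ks wfp s0 s1.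
- by exists 1%N.
- by exists 1%N.
- by exists 1%N.
- case/andP: wfp => wfp wfq.
  have [t tc tE] := IHp s (compile q :: ks) wfp s0 s1.
  have [pn _] := exec_same p s.
  have [|| t' t'c t'E] := IHq (exec p s) ks wfq; rewrite ?pn ?wf_wnat //.
  exists (t' + t + 1)%N; first by rewrite /= add1n addn1 ltnS addnC leq_add.
  by rewrite iterD /= iterD tE t'E.
- case/andP: wfp => wfp wfq; case bE: (beval s b) => /=.
    have [t tc tE] := IHp s ks wfp s0 s1.
    exists t.+1; first by rewrite /= add1n ltnS (leq_trans tc) ?leq_addr.
    by rewrite iterSr /= bE tE.
  have [t tc tE] := IHq s ks wfq s0 s1.
  exists t.+1; first by rewrite /= add1n ltnS (leq_trans tc) ?leq_addl.
  by rewrite iterSr /= bE tE.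
have {wfp} /and4P[N1 x1 xp wfp] := wfp.
have ND : (nmem s N 0%N 0%N <= D)%N by case: N N1 => [|[]].
have Nx : N != x by apply: contraTneq x1 => <-; rewrite -leqNgt.
have y_x y : (y <= 1)%N -> y != x by apply: contraTneq => ->; rewrite -ltnNge.
rewrite [exec _ _]/=; set body := fun s' => _.
pose W := While (NLt (scalar x) (scalar N))
  (Seq (compile p) (NSet x (NLit 0) (NLit 0) (NAdd (scalar x) (NLit 1)))).
(* The claim starts from an arbitrary intermediate iteration [j], so that the induction can run on
   the number of iterations still to come. *)
suff: forall j, (j <= nmem s N 0%N 0%N)%N ->
    exists2 t, (t <= 1 + (nmem s N 0%N 0%N - j) * (3 + cost p D))%N &
      iter t (@step R) (W :: ks, iter j body (setn s x 0))
        = (ks, iter (nmem s N 0%N 0%N) body (setn s x 0)).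
  move=> /(_ 0%N (leq0n _))[t tc tE]; exists (t + 2)%N.
    rewrite /= addnC (leq_trans (leq_add (leqnn 2) tc)) // subn0.
    by rewrite addnA leq_add2l leq_mul2r ND orbT.
  by rewrite iterD /= tE.
move=> j jN; have [i ij] : exists i, i = (nmem s N 0%N 0%N - j)%N.
  by exists (nmem s N 0%N 0%N - j)%N.
have inv l : (l <= nmem s N 0%N 0%N)%N -> let s' := iter l body (setn s x 0) in
    nmem s' x 0%N 0%N = l /\ (forall y, (y <= 1)%N -> nmem s' y 0%N 0%N = nmem s y 0%N 0%N).
  elim: l => [|l IHl] lN.
    by split=> [|y y1]; rewrite /= ?upd_eq // upd_neq ?y_x.
  have [xl yl] := IHl (ltnW lN); have [pn _] := exec_same p (iter l body (setn s x 0)).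
  split=> [|y y1]; first by rewrite /= upd_eq pn // xl.
  by rewrite /= upd_neq ?y_x // pn ?yl ?wf_wnat.
elim: i j jN ij => [|i IHi] j jN ij.
  have -> : j = nmem s N 0%N 0%N by apply/eqP; rewrite eqn_leq jN -subn_eq0 -ij /=.
  have [xN yN] := inv _ (leqnn (nmem s N 0%N 0%N)).
  by exists 1%N => //=; rewrite xN yN // ltnn.
have jN' : (j < nmem s N 0%N 0%N)%N by rewrite -subn_gt0 -ij.
have iE : i = (nmem s N 0%N 0%N - j.+1)%N by rewrite subnS -ij.
have [t tc tE] := IHi j.+1 jN' iE.
have [xj yj] := inv _ jN; set sj := iter j body _ in xj yj *.
have [||t' t'c t'E] := IHp sj
  (NSet x (NLit 0) (NLit 0) (NAdd (scalar x) (NLit 1)) :: W :: ks) wfp; rewrite ?yj //.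
exists (t + (1 + (t' + 2)))%N.
  by rewrite -ij mulSn; move: tc t'c; rewrite -iE; set v := (i * _)%N; clear; lia.
rewrite iterD iterD iterD [iter 2 _ _]/= xj yj // jN' t'E /=.
by rewrite addn1 -tE /=.
Qed.

Lemma halts_compile p : wf p -> exists c, forall s (d n : nat),
  nmem s 0%N 0%N 0%N = d -> nmem s 1%N 0%N 0%N = n ->
  halts_within (compile p) s (c * (d + n).+1 ^ c) (exec p s).
Proof.
move=> wfp; have [c cP] := cost_poly p; exists c => s d n sd sn.
have [||t tc tE] := @run_compile p s [::] (d + n) wfp; rewrite ?sd ?sn ?leq_addr ?leq_addl //.
by exists t => //; apply: leq_trans (cP _).
Qed.

End Semantics.

(** * The algorithm *)

Definition entry (x i : nat) : nexp := NGet x (scalar i) (NLit 0).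
Definition rscalar (x : nat) : rexp := RGet x (NLit 0) (NLit 0).
Definition rentry (x i : nat) : rexp := RGet x (scalar i) (NLit 0).
Definition rentry2 (x i j : nat) : rexp := RGet x (scalar i) (scalar j).
Definition nassign (x : nat) (e : nexp) : prog := PN x (NLit 0) (NLit 0) e.
Definition rassign (x : nat) (e : rexp) : prog := PR x (NLit 0) (NLit 0) e.
Definition set_entry (x i : nat) (e : nexp) : prog := PN x (scalar i) (NLit 0) e.

Local Notation "p ;; q" := (PSeq p q) (at level 60, right associativity).

(* Memory layout: the natural arrays [vX] to [vTb] hold subsets of the columns as
   0/1 vectors, the natural cells [vt] to [vc] are scalars, and the scalars 21 to
   34 are loop counters. *)
Local Notation vX := 4%N.
Local Notation vB := 5%N.
Local Notation vT := 6%N.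
Local Notation vP := 7%N.
Local Notation vS := 8%N.
Local Notation vBb := 9%N.
Local Notation vTb := 10%N.
Local Notation vt := 11%N.
Local Notation vu := 12%N.
Local Notation vp := 13%N.
Local Notation vg := 14%N.
Local Notation vb := 15%N.
Local Notation vw := 16%N.
Local Notation vf := 17%N.
Local Notation vwi := 18%N.
Local Notation vwj := 19%N.
Local Notation vc := 20%N.
Local Notation rZ := 6%N.
Local Notation rv := 7%N.
Local Notation rvv := 8%N.
Local Notation rc := 9%N.
Local Notation rr := 10%N.
Local Notation rlo := 11%N.
Local Notation rnu := 12%N.
Local Notation rnub := 13%N.

Definition pivot_prog : prog :=
  PFor 0 22 (PR rv (scalar 22) (NLit 0) (rentry2 rZ 22 23) ;;
             rassign rvv (RAdd (rscalar rvv) (RMul (rentry2 rZ 22 23) (rentry2 rZ 22 23)))).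

Definition coef_prog : prog :=
  PFor 0 22 (rassign rc (RAdd (rscalar rc) (RMul (rentry2 rZ 22 21) (rentry rv 22)))).

Definition subtract_prog : prog :=
  PFor 0 22 (PR rZ (scalar 22) (scalar 21)
    (RSub (rentry2 rZ 22 21) (RMul (RDiv (rscalar rc) (rscalar rvv)) (rentry rv 22)))).

Definition column_prog : prog :=
  rassign rc (RNat (NLit 0)) ;; coef_prog ;; subtract_prog.

(** One step of Gram-Schmidt orthogonalization, applied to all columns of [rZ]. The pivot is copied
    to [rv] first, because the pivot column itself becomes zero during the step. *)
Definition project_prog : prog :=
  rassign rvv (RNat (NLit 0)) ;; pivot_prog ;; PFor 1 21 column_prog.

Definition load_prog : prog :=
  PFor 1 21 (PFor 0 22 (PR rZ (scalar 22) (scalar 21) (rentry2 0 22 21))).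

Definition sweep_prog : prog :=
  PFor 1 23 (PIf (NLt (NLit 0) (entry vX 23)) project_prog PSkip).

Definition norm_prog : prog :=
  PFor 1 21 (PR rr (scalar 21) (NLit 0) (RNat (NLit 0)) ;;
             PFor 0 22 (PR rr (scalar 21) (NLit 0)
               (RAdd (rentry rr 21) (RMul (rentry2 rZ 22 21) (rentry2 rZ 22 21))))).

Definition resid_prog : prog := load_prog ;; sweep_prog ;; norm_prog.

Definition setfor_prog (x : nat) (e : nexp) : prog := PFor 1 24 (set_entry x 24 e).

Definition copy_prog (x y : nat) : prog := setfor_prog x (entry y 24).

(** On 0/1 entries, truncated subtraction makes the new entry the maximum of the two. *)
Definition union_prog (x y : nat) : prog :=
  setfor_prog x (NAdd (entry x 24) (NSub (entry y 24) (entry x 24))).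

Definition card_prog (x y : nat) : prog :=
  nassign x (NLit 0) ;; PFor 1 24 (nassign x (NAdd (scalar x) (entry y 24))).

(* [x] becomes the least value below [n] that violates [b], or [n]. *)
Definition search_prog (x : nat) (b : bexp) : prog :=
  nassign x (NLit 0) ;; PFor 1 34 (PIf b (nassign x (NAdd (scalar x) (NLit 1))) PSkip).

Definition outside_block (x : nat) : bexp :=
  BAnd (NLt (NLit 0) (entry vP x)) (NLt (entry vB x) (NLit 1)).

(** A disjunction written with [BNot] and [BAnd]: no candidate has been found yet, or the present
    one has a smaller residual. The flag [vf] is needed since the best residual may be zero. *)
Definition farthest_test : bexp :=
  BAnd (outside_block 26)
    (BNot (BAnd (NLt (NLit 0) (scalar vf))
                (BNot (RLt (RGet rr (scalar vw) (NLit 0)) (rentry rr 26))))).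

Definition farthest_prog : prog :=
  nassign vf (NLit 0) ;;
  PFor 1 26 (PIf farthest_test (nassign vw (scalar 26) ;; nassign vf (NLit 1)) PSkip).

Definition greedy_step : prog :=
  copy_prog vX vB ;; resid_prog ;; farthest_prog ;;
  PIf (NLt (NLit 0) (scalar vf)) (set_entry vB vw (NLit 1)) PSkip.

(** A loop up to [vb] is expressed as a loop up to [n] with a guarded body; the same device recurs
    below. *)
Definition greedy_prog : prog :=
  setfor_prog vB (NLit 0) ;;
  PFor 1 25 (PIf (NLt (scalar 25) (scalar vb)) greedy_step PSkip).

Definition swap_test : bexp :=
  BAnd (outside_block 28)
    (RLt (RMul (RAdd (RNat (NLit 1)) (RDiv (rscalar 1) (RNat (NLit 8)))) (rscalar rlo))
         (rentry rr 28)).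

Definition find_swap_inner : prog :=
  PFor 1 28 (PIf swap_test
    (nassign vwi (scalar 28) ;; nassign vwj (scalar 27) ;; nassign vf (NLit 1)) PSkip).

Definition loo_prog : prog :=
  copy_prog vX vB ;; set_entry vX 27 (NLit 0) ;; resid_prog ;;
  rassign rlo (rentry rr 27) ;; copy_prog vX vB ;; resid_prog.

Definition find_swap_prog : prog :=
  nassign vf (NLit 0) ;;
  PFor 1 27 (PIf (NLt (NLit 0) (entry vB 27)) (loo_prog ;; find_swap_inner) PSkip).

Definition swap_step : prog :=
  find_swap_prog ;;
  PIf (NLt (NLit 0) (scalar vf))
    (set_entry vB vwj (NLit 0) ;; set_entry vB vwi (NLit 1)) PSkip.

(** The three nested loops allow as many exchanges as [fact_lt_growth] requires; once the set is
    stable, further steps leave it alone. *)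
Definition local_search_prog : prog :=
  PFor 1 29 (PFor 1 30 (PFor 1 31 swap_step)).

Definition max_prog : prog :=
  rassign rnu (RNat (NLit 0)) ;;
  PFor 1 26 (PIf (BAnd (NLt (NLit 0) (entry vP 26)) (RLt (rscalar rnu) (rentry rr 26)))
               (rassign rnu (rentry rr 26)) PSkip).

Definition block_prog : prog :=
  greedy_prog ;; local_search_prog ;; copy_prog vX vB ;; resid_prog ;;
  setfor_prog vP (NSub (entry vP 24) (entry vB 24)) ;; max_prog.

Definition select_test : bexp :=
  BNot (BAnd (NLt (NLit 0) (scalar 32)) (BNot (RLt (rscalar rnu) (rscalar rnub)))).

Definition select_prog : prog :=
  PIf select_test
    (rassign rnub (rscalar rnu) ;; copy_prog vBb vB ;; copy_prog vTb vP) PSkip.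

Definition blocks_prog : prog :=
  copy_prog vP vT ;;
  PFor 1 32 (PIf (NLt (scalar 32) (scalar vp)) (block_prog ;; select_prog) PSkip).

Definition remove_prog : prog :=
  nassign vc (NLit 0) ;;
  PFor 1 26 (PIf (BAnd (NLt (NLit 0) (entry vTb 26)) (NLt (scalar vc) (scalar vg)))
    (set_entry vT 26 (NLit 0) ;; nassign vc (NAdd (scalar vc) (NLit 1))) PSkip).

Definition succ_nat (x : nat) : rexp := RNat (NAdd (scalar x) (NLit 1)).

(* [u] is about [16 k / eps]. *)
Definition u_prog : prog :=
  search_prog vu (RLt (RMul (RNat (scalar vu)) (rscalar 1))
                      (RMul (RNat (NLit 16)) (RNat (scalar 2)))).

Definition p_test : bexp :=
  BNot (RLt (RMul (RNat (NSub (scalar vt) (scalar 3))) (rscalar 1))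
            (RMul (RNat (NLit 16)) (RMul (succ_nat vp) (RNat (scalar vu))))).

(* The largest [p] with [16 p u <= eps (t - m)]. *)
Definition p_prog : prog := search_prog vp p_test.

Definition g_prog : prog :=
  nassign vg (NLit 0) ;;
  PFor 1 34 (PIf (NLt (scalar 34) (scalar vp)) (nassign vg (NAdd (scalar vg) (scalar vu))) PSkip).

Definition b_test : bexp :=
  BNot (RLt (RNat (NSub (scalar vt) (scalar vg))) (RMul (succ_nat vb) (RNat (scalar vp)))).

(* The largest [b] with [b p <= t - g]. *)
Definition b_prog : prog := search_prog vb b_test.

(** If [p] is 0 then [t - m] is below [16 u / eps], and the last active columns are few enough to be
    chosen all at once. *)
Definition round_prog : prog :=
  p_prog ;;
  PIf (NLt (NLit 0) (scalar vp))
    (g_prog ;; b_prog ;; blocks_prog ;; union_prog vS vBb ;; remove_prog)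
    (union_prog vS vT ;; setfor_prog vT (NLit 0)).

Definition main_test : bexp :=
  RLt (RMul (RAdd (RNat (NLit 1)) (rscalar 2)) (RNat (scalar 3))) (RNat (scalar vt)).

(** Each round that is executed deactivates at least one column, so [n] iterations reach the
    stopping condition. *)
Definition main_prog : prog :=
  PFor 1 33 (card_prog vt vT ;; PIf main_test round_prog PSkip).

Definition output_entry (x : nat) : prog := PR x (scalar 22) (scalar 21) (rentry2 0 22 21).

Definition output_prog : prog :=
  PFor 1 21 (PFor 0 22
    (PIf (NLt (NLit 0) (entry vT 21)) (output_entry 4) (output_entry 3) ;;
     PIf (NLt (NLit 0) (entry vS 21)) (output_entry 5) PSkip)).

Definition pca_prog : prog :=
  setfor_prog vT (NLit 1) ;; u_prog ;; main_prog ;; output_prog.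

(** The bounds 4 and 3 protect the input: natural scalars 0 to 3 and real arrays 0 to 2 are never
    written. *)
Definition loop_ok (x : nat) (p : prog) : bool :=
  [&& (4 <= x)%N, x \notin wnat p, all (leq 4) (wnat p) & all (leq 3) (wreal p)].

(** * Correctness of the algorithm *)

Section Environment.
Variables (R : realType) (d n : nat) (A : 'M[R]_(d, n)) (k m : nat) (eps delta : R).
Implicit Types (s : state R) (p : prog) (X B T S : {set 'I_n}).

Local Notation resid B i := (dist2 (col_span A B) (col i A)).

Definition env s : Prop :=
  [/\ nmem s 0%N 0%N 0%N = d, nmem s 1%N 0%N 0%N = n, nmem s 2%N 0%N 0%N = k
    & nmem s 3%N 0%N 0%N = m]%N /\
  [/\ forall (i : 'I_d) (j : 'I_n), rmem s 0%N i j = A i j,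
      rmem s 1%N 0%N 0%N = eps & rmem s 2%N 0%N 0%N = delta].

Lemma same_env wn wr s s' : same wn wr s s' -> all (leq 4) wn -> all (leq 3) wr ->
  env s -> env s'.
Proof.
move=> [sn sr] /allP wn4 /allP wr3 [[e0 e1 e2 e3] [eA e4 e5]].
have nn y : (y < 4)%N -> y \notin wn by move=> y4; apply/negP => /wn4; rewrite leqNgt y4.
have nr y : (y < 3)%N -> y \notin wr by move=> y3; apply/negP => /wr3; rewrite leqNgt y3.
by split; split=> // *; rewrite ?sn ?sr ?nn ?nr.
Qed.

Lemma exec_env p s : all (leq 4) (wnat p) -> all (leq 3) (wreal p) -> env s -> env (exec p s).
Proof. by move=> wn wr; apply: same_env (exec_same p s) wn wr. Qed.

Lemma for_n x p s (P : nat -> state R -> Prop) :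
    loop_ok x p -> env s ->
    (forall j s' v, P j s' -> P j (setn s' x v)) ->
    P 0%N s ->
    (forall (j : 'I_n) s', nmem s' x 0%N 0%N = j -> env s' ->
       same (x :: wnat p) (wreal p) s s' -> P j s' -> P j.+1 (exec p s')) ->
  P n (exec (PFor 1 x p) s).
Proof.
case/and4P=> x4 xp wn wr es Px P0 PS; have [[_ e1 _ _] _] := es.
rewrite -{1}e1; apply: (@exec_for_inv R 1 x p s P) => //.
  rewrite inE negb_or; apply/andP; split; first by apply: contraTneq x4 => <-.
  by apply/negP => /(allP wn).
move=> j s'; rewrite e1 => jn xj sj Pj; apply: (PS (Ordinal jn)) => //.
by apply: same_env sj _ _ es => //=; rewrite x4.
Qed.

Lemma for_d x p s (P : nat -> state R -> Prop) :
    loop_ok x p -> env s ->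
    (forall j s' v, P j s' -> P j (setn s' x v)) ->
    P 0%N s ->
    (forall (i : 'I_d) s', nmem s' x 0%N 0%N = i -> env s' ->
       same (x :: wnat p) (wreal p) s s' -> P i s' -> P i.+1 (exec p s')) ->
  P d (exec (PFor 0 x p) s).
Proof.
case/and4P=> x4 xp wn wr es Px P0 PS; have [[e0 _ _ _] _] := es.
rewrite -{1}e0; apply: (@exec_for_inv R 0 x p s P) => //.
  rewrite inE negb_or; apply/andP; split; first by apply: contraTneq x4 => <-.
  by apply/negP => /(allP wn).
move=> j s'; rewrite e0 => jn xj sj Pj; apply: (PS (Ordinal jn)) => //.
by apply: same_env sj _ _ es => //=; rewrite x4.
Qed.

Lemma exec_seq p q s : exec (p ;; q) s = exec q (exec p s). Proof. by []. Qed.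
Lemma exec_if b p q s : exec (PIf b p q) s = if beval s b then exec p s else exec q s.
Proof. by []. Qed.

Lemma exec_ifT b p q s : beval s b -> exec (PIf b p q) s = exec p s.
Proof. by rewrite exec_if => ->. Qed.
Lemma exec_ifF b p q s : beval s b = false -> exec (PIf b p q) s = exec q s.
Proof. by rewrite exec_if => ->. Qed.

Lemma ltS_ord N (i j : 'I_N) : (j < i.+1)%N = (j == i) || (j < i)%N.
Proof. by rewrite ltnS leq_eqVlt (inj_eq val_inj). Qed.

Lemma sum_ltS N (i : 'I_N) (f : 'I_N -> R) :
  \sum_(j < N | (j < i.+1)%N) f j = \sum_(j < N | (j < i)%N) f j + f i.
Proof.
rewrite (bigD1 i) //= addrC; congr (_ + _); apply: eq_bigl => j.
by rewrite ltnS leq_eqVlt andbC -(inj_eq val_inj) /=; case: ltngtP.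
Qed.

Lemma sum_lt_all N (f : 'I_N -> R) : \sum_(j < N | (j < N)%N) f j = \sum_j f j.
Proof. by apply: eq_bigl => j; rewrite ltn_ord. Qed.

Definition zcol s (j : 'I_n) : 'cV[R]_d := \col_i rmem s rZ i j.

Lemma zcol_same wn wr s s' j : same wn wr s s' -> rZ \notin wr -> zcol s' j = zcol s j.
Proof. by move=> [_ sr] /sr E; apply/colP => i; rewrite !mxE E. Qed.

Lemma project_prog_spec s (l : 'I_n) (w : 'I_n -> 'cV[R]_d) :
    env s -> nmem s 23%N 0%N 0%N = l -> (forall j, zcol s j = w j) ->
  forall j, zcol (exec project_prog s) j
    = w j - (dotv (w j) (w l) / dotv (w l) (w l)) *: w l.
Proof.
move=> es sl zw; rewrite /project_prog !exec_seq.
set s1 := exec (rassign _ _) s; set p2 := pivot_prog; set p3 := PFor 1 21 _.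
have es1 : env s1 by apply: exec_env es.
have z1 j : zcol s1 j = w j by rewrite (zcol_same _ (exec_same _ _)).
have [v2 vv2] : (forall i : 'I_d, rmem (exec p2 s1) rv i 0%N = w l i 0) /\
    rmem (exec p2 s1) rvv 0%N 0%N = dotv (w l) (w l).
  pose P i s' := (forall i' : 'I_d, (i' < i)%N -> rmem s' rv i' 0%N = w l i' 0) /\
    rmem s' rvv 0%N 0%N = \sum_(i' < d | (i' < i)%N) w l i' 0 * w l i' 0.
  suff [H1 H2] : P d (exec p2 s1).
    by split=> [i|]; [apply: H1|rewrite H2 sum_lt_all dotvE].
  apply: for_d => //; first by split=> //; rewrite big_pred0.
  move=> i s' s'i es' ss' [Pv Pvv].
  have zs' : rmem s' rZ i l = w l i 0.
    by have := zcol_same l ss' isT; rewrite z1 => /colP/(_ i); rewrite mxE.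
  have s'l : nmem s' 23%N 0%N 0%N = l by rewrite ss'.1.
  split=> [i'|]; rewrite /= /upd /= s'i.
    rewrite ltnS leq_eqVlt s'l; have [/val_inj -> _|ii'] /= := eqVneq (val i') (val i); first by [].
    by move=> i'i; apply: Pv.
  by rewrite s'l zs' Pvv sum_ltS.
set s2 := exec p2 s1 in v2 vv2 *.
have es2 : env s2 by apply: exec_env es1.
have z2 j : zcol s2 j = w j by rewrite (zcol_same _ (exec_same _ _)).
pose P j s' := forall j' : 'I_n,
  zcol s' j' = if (j' < j)%N then w j' - (dotv (w j') (w l) / dotv (w l) (w l)) *: w l
               else w j'.
suff H : P n (exec p3 s2) by move=> j; rewrite H ltn_ord.
apply: for_n => // j s' s'j es' ss' Pj; rewrite !exec_seq.
set s3 := exec (rassign _ _) s'; set p4 := coef_prog; set p5 := subtract_prog.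
have es3 : env s3 by apply: exec_env es'.
have v3 (i : 'I_d) : rmem s3 rv i 0%N = w l i 0 by rewrite -v2 -ss'.2.
have z3 j' : zcol s3 j' = zcol s' j' by rewrite (zcol_same _ (exec_same _ _)).
have s3j : nmem s3 21%N 0%N 0%N = j by [].
have c4 : rmem (exec p4 s3) rc 0%N 0%N = dotv (w j) (w l).
  pose Q i s'' := rmem s'' rc 0%N 0%N = \sum_(i' < d | (i' < i)%N) w j i' 0 * w l i' 0.
  suff : Q d (exec p4 s3) by rewrite /Q sum_lt_all dotvE.
  apply: for_d => //; first by rewrite /Q big_pred0.
  move=> i s'' s''i es'' ss'' Qi; rewrite /Q /= /upd /= s''i Qi sum_ltS; congr (_ + _).
  rewrite (ss''.1 21%N) // s3j (ss''.2 rv) // v3; congr (_ * _).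
  have := zcol_same j ss'' isT; rewrite z3 Pj ltnn => /colP/(_ i).
  by rewrite mxE.
set s4 := exec p4 s3 in c4 *.
have es4 : env s4 by apply: exec_env es3.
have ss4 := exec_same p4 s3.
pose Q i s'' := forall (i' : 'I_d) (j' : 'I_n), rmem s'' rZ i' j'
  = if (j' == j) && (i' < i)%N
    then w j i' 0 - dotv (w j) (w l) / dotv (w l) (w l) * w l i' 0 else zcol s' j' i' 0.
suff H : Q d (exec p5 s4).
  move=> j'; apply/colP => i; rewrite [LHS]mxE H ltn_ord andbT ltnS leq_eqVlt.
  rewrite -(inj_eq val_inj); have [/val_inj ->|_] /= := eqVneq (val j') (val j).
    by rewrite !mxE.
  by rewrite Pj.
apply: for_d => //.
  move=> i' j'; rewrite ltn0 andbF -z3.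
  by have := zcol_same j' ss4 isT => /colP/(_ i') <-; rewrite mxE.
move=> i s'' s''i es'' ss'' Qi i' j'; rewrite /= /upd /= s''i.
have s''j : nmem s'' 21%N 0%N 0%N = j by rewrite ss''.1 // ss4.1.
rewrite s''j; have -> : (val j' == val j) = (j' == j) by rewrite (inj_eq val_inj).
have -> : (val i' == val i) = (i' == i) by rewrite (inj_eq val_inj).
rewrite ltS_ord andbC; case: (eqVneq j' j) => [->|jj'] /=; last first.
  by rewrite Qi (negPf jj').
have rv'' (i0 : 'I_d) : rmem s'' rv i0 0%N = w l i0 0 by rewrite ss''.2 // ss4.2 // v3.
have rvv'' : rmem s'' rvv 0%N 0%N = dotv (w l) (w l).
  by rewrite ss''.2 // ss4.2 // [LHS]ss'.2.
have rc'' : rmem s'' rc 0%N 0%N = dotv (w j) (w l) by rewrite ss''.2.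
case: (eqVneq i' i) => [->|ii'] /=; last by rewrite Qi eqxx.
by rewrite Qi ltnn andbF Pj ltnn rvv'' rc'' rv''.
Qed.

Definition isset s x X : Prop := forall j : 'I_n, nmem s x j 0%N = (j \in X).

Lemma isset_same wn wr s s' x X : same wn wr s s' -> x \notin wn ->
  isset s x X -> isset s' x X.
Proof. by move=> [sn _] /sn E sX j; rewrite E sX. Qed.

Lemma resid_prog_spec s X : env s -> isset s vX X ->
  forall j : 'I_n, rmem (exec resid_prog s) rr j 0%N = resid X j.
Proof.
move=> es sX; rewrite /resid_prog !exec_seq.
set p1 := load_prog; set p2 := sweep_prog; set p3 := norm_prog.
have z1 j : zcol (exec p1 s) j = col j A.
  pose P j s' := forall j' : 'I_n, (j' < j)%N -> zcol s' j' = col j' A.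
  suff H : P n (exec p1 s) by apply: H.
  apply: for_n => // {}j s' s'j es' ss' Pj; set p4 := PFor 0 22 _.
  pose Q i s'' := forall (i' : 'I_d) (j' : 'I_n),
    (j' < j)%N || (j' == j) && (i' < i)%N -> rmem s'' rZ i' j' = A i' j'.
  suff H : Q d (exec p4 s').
    move=> j' j'j; apply/colP => i; rewrite !mxE; apply: H.
    by move: j'j; rewrite ltnS leq_eqVlt ltn_ord andbT orbC.
  apply: for_d => //.
    move=> i' j'; rewrite ltn0 andbF orbF => /Pj/colP/(_ i').
    by rewrite !mxE.
  move=> i s'' s''i es'' ss'' Qi i' j'; rewrite /= /upd /= s''i.
  have s''j : nmem s'' 21%N 0%N 0%N = j by rewrite ss''.1.
  rewrite s''j; have -> : (val j' == val j) = (j' == j) by rewrite (inj_eq val_inj).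
  have -> : (val i' == val i) = (i' == i) by rewrite (inj_eq val_inj).
  rewrite ltS_ord; case: (eqVneq i' i) => [->|ii'] /=; last first.
    exact: Qi.
  rewrite andbT; case: (eqVneq j' j) => [-> _|jj'] /=; first by have [_ [-> _ _]] := es''.
  by rewrite orbF => j'j; apply: Qi; rewrite j'j.
set s1 := exec p1 s in z1 *.
have es1 : env s1 by apply: exec_env es.
have sX1 : isset s1 vX X by apply: isset_same (exec_same _ _) _ sX.
have z2 j : zcol (exec p2 s1) j = perp_proj (col_span A X) (col j A).
  (* A column of [X] that depends on earlier ones is a zero pivot by the time it is reached;
     [perp_proj_add] covers this case as well. *)
  pose P l s' := forall j : 'I_n,
    zcol s' j = perp_proj (col_span A [set i in X | (i < l)%N]) (col j A).
  suff H : P n (exec p2 s1).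
    by rewrite H; congr (perp_proj (col_span A _) _); apply/setP => i; rewrite inE ltn_ord andbT.
  apply: for_n => //.
    move=> {}j; rewrite z1; have -> : [set i in X | (i < 0)%N] = finset.set0.
      by apply/setP => i; rewrite !inE ltn0 andbF.
    rewrite col_span0; apply/esym/perp_projE; rewrite ?subrr ?mem0v //.
    by apply/orthocomplP => v; rewrite memv0 => /eqP ->; rewrite linear0r.
  move=> l s' s'l es' ss' Pl; rewrite exec_if /=.
  have sX' : isset s' vX X by apply: isset_same ss' _ sX1.
  have -> : nmem s' 23%N 0%N 0%N = l by [].
  rewrite sX'; case: (boolP (l \in X)) => lX /=; last first.
    move=> {}j; rewrite Pl; congr (perp_proj (col_span A _) _); apply/setP => i.
    rewrite !inE ltS_ord; case: (eqVneq i l) => [->|//].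
    by rewrite (negPf lX).
  move=> {}j; rewrite (project_prog_spec es' s'l Pl); rewrite -perp_proj_add.
  rewrite -col_spanU1; congr (perp_proj (col_span A _) _); apply/setP => i.
  by rewrite !inE ltS_ord; case: (eqVneq i l) => [->|] /=; rewrite ?lX.
set s2 := exec p2 s1 in z2 *.
have es2 : env s2 by apply: exec_env es1.
pose P j s' := forall j' : 'I_n, (j' < j)%N -> rmem s' rr j' 0%N = resid X j'.
suff H : P n (exec p3 s2) by move=> j; apply: H.
apply: for_n => // j s' s'j es' ss' Pj; rewrite exec_seq.
set s3 := exec (PR _ _ _ _) s'; set p4 := PFor 0 22 _.
have es3 : env s3 by apply: exec_env es'.
have z3 j' : zcol s3 j' = perp_proj (col_span A X) (col j' A).
  by rewrite (zcol_same _ (exec_same _ _)) // (zcol_same _ ss').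
pose Q i s'' := (forall j' : 'I_n, (j' < j)%N -> rmem s'' rr j' 0%N = resid X j') /\
  rmem s'' rr j 0%N = \sum_(i' < d | (i' < i)%N) zcol s3 j i' 0 * zcol s3 j i' 0.
suff [H1 H2] : Q d (exec p4 s3).
  move=> j'; rewrite ltnS leq_eqVlt => /predU1P[/val_inj ->|/H1 //].
  by rewrite H2 sum_lt_all -dotvE z3.
apply: for_d => //.
  split=> [j' j'j|]; rewrite /= /upd /= s'j; last by rewrite eqxx big_pred0.
  by rewrite ltn_eqF // Pj.
move=> i s'' s''i es'' ss'' [Q1 Q2].
have s''j : nmem s'' 21%N 0%N 0%N = j by rewrite ss''.1.
split=> [j' j'j|]; rewrite /= /upd /= s''j; first by rewrite ltn_eqF //= Q1.
rewrite eqxx /= Q2 sum_ltS s''i; congr (_ + _).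
have /colP/(_ i) := zcol_same j ss'' isT; rewrite !mxE => E.
by rewrite E.
Qed.

(** When entry [j] is computed it still has its original value, so [e] may read the very array that
    is being overwritten, as union and difference do. *)
Lemma setfor_spec (x : nat) e s X : env s -> (4 <= x)%N -> x != 24%N ->
    (forall (j : 'I_n) s', nmem s' 24%N 0%N 0%N = j -> same [:: 24%N; x] [::] s s' ->
       nmem s' x j 0%N = nmem s x j 0%N -> neval s' e = (j \in X)) ->
  isset (exec (setfor_prog x e) s) x X.
Proof.
move=> es x4 x24 eX.
pose P (j : nat) s' := forall j' : 'I_n,
  nmem s' x j' 0%N = if (j' < j)%N then nat_of_bool (j' \in X) else nmem s x j' 0%N.
suff H : P n (exec (setfor_prog x e) s) by move=> j; rewrite H ltn_ord.
apply: for_n => //.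
- by rewrite /loop_ok /= !inE eq_sym x24 x4.
- by move=> j s' v Pj j'; rewrite -Pj /= upd_neq.
move=> j s' s'j es' ss' Pj j' /=; rewrite /upd eqxx s'j /= ltS_ord.
have -> : (val j' == val j) = (j' == j) by rewrite (inj_eq val_inj).
case: (eqVneq j' j) => [->|_] /=; last exact: Pj.
by apply: eX => //; rewrite Pj ltnn.
Qed.

Lemma copy_spec (x y : nat) s X : env s -> (4 <= x)%N -> x != 24%N -> y \notin [:: 24%N; x] ->
  isset s y X -> isset (exec (copy_prog x y) s) x X.
Proof.
move=> es x4 x24 yx sX; apply: setfor_spec => // j s' s'j ss' _ /=.
by rewrite s'j ss'.1.
Qed.

Lemma union_spec (x y : nat) s X Y : env s -> (4 <= x)%N -> x != 24%N -> y \notin [:: 24%N; x] ->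
  isset s x X -> isset s y Y -> isset (exec (union_prog x y) s) x (X :|: Y).
Proof.
move=> es x4 x24 yx sX sY; apply: setfor_spec => // j s' s'j ss' s'x /=.
by rewrite s'j s'x ss'.1 // sX sY inE; case: (j \in X) (j \in Y) => [] [].
Qed.

Lemma card_spec (x y : nat) s X : env s -> (4 <= x)%N -> x != 24%N -> y \notin [:: 24%N; x] ->
  isset s y X -> nmem (exec (card_prog x y) s) x 0%N 0%N = #|X|.
Proof.
move=> es x4 x24 yx sX; rewrite /card_prog exec_seq.
set s1 := exec _ s; have es1 : env s1 by apply: exec_env es; rewrite //= x4.
have ss1 : same [:: x] [::] s s1 := exec_same (nassign x (NLit 0)) s.
have x_y : y != x by move: yx; rewrite !inE negb_or => /andP[].
have sX1 : isset s1 y X by apply: isset_same ss1 _ sX; rewrite inE.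
pose P (j : nat) s' := nmem s' x 0%N 0%N = #|[set i in X | (i < j)%N]|.
set s2 := exec _ s1; suff : P n s2.
  by rewrite /P => ->; apply: eq_card => i; rewrite inE ltn_ord andbT.
apply: for_n => //.
- by rewrite /loop_ok /= !inE eq_sym x24 x4.
- by move=> j s' v; rewrite /P /= upd_neq.
- rewrite /P /s1 /= upd_eq; apply/esym/eq_card0 => i; by rewrite !inE ltn0 andbF.
move=> j s' s'j es' ss'; rewrite /P /= upd_eq => ->; rewrite s'j ss'.1 // sX1.
rewrite (cardsD1 j [set i in X | (i < j.+1)%N]) !inE ltnSn andbT addnC; congr (_ + _)%N.
apply: eq_card => i; rewrite !inE ltS_ord.
by case: (eqVneq i j) => [->|] //=; rewrite ltnn andbF.
Qed.

Lemma search_spec (x : nat) b s (c : pred nat) : env s -> (4 <= x)%N -> x != 34%N ->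
    (forall s', same [:: 34%N; x] [::] s s' -> beval s' b = c (nmem s' x 0%N 0%N)) ->
  let v := nmem (exec (search_prog x b) s) x 0%N 0%N in
  [/\ (v <= n)%N, forall v', (v' < v)%N -> c v' & v = n \/ ~~ c v].
Proof.
move=> es x4 x34 bc; rewrite /search_prog exec_seq.
set s1 := exec (nassign _ _) s; have es1 : env s1 by apply: exec_env es; rewrite //= x4.
have ss1 : same [:: 34%N; x] [::] s s1.
  by apply: sub_same (exec_same (nassign x (NLit 0)) s) => // y; rewrite !inE => ->; rewrite orbT.
pose P (j : nat) s' := let v := nmem s' x 0%N 0%N in
  [/\ (v <= j)%N, forall v', (v' < v)%N -> c v' & v = j \/ ~~ c v].
apply: (@for_n _ _ s1 P) => //.
- by rewrite /loop_ok /= !inE eq_sym x34 x4.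
- by move=> j s' v; rewrite /P /= upd_neq.
- by rewrite /P /s1 /= upd_eq; split=> //; left.
move=> j s' s'j es' ss' [vj cv vE]; rewrite exec_if.
have ss'' : same [:: 34%N; x] [::] s s' by apply: same_trans ss1 _.
rewrite bc //; case: ifP => cx; rewrite /P /= ?upd_eq.
  rewrite addn1 ltnS; split=> // [v'|].
    by rewrite ltnS leq_eqVlt => /predU1P[->|/cv].
  by left; case: vE => [->|]; rewrite ?cx.
split=> //; first exact: leq_trans vj (leqnSn _).
by right; rewrite cx.
Qed.

(** * Greedy selection, local search and the blocks of a round *)

Lemma farthest_spec s T B (f : 'I_n -> R) : env s -> isset s vP T -> isset s vB B ->
    (forall j : 'I_n, rmem s rr j 0%N = f j) ->
  let s' := exec farthest_prog s in
  (nmem s' vf 0%N 0%N = 0%N /\ T \subset B) \/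
  (nmem s' vf 0%N 0%N = 1%N /\ exists w : 'I_n, [/\ nmem s' vw 0%N 0%N = w, w \in T, w \notin B
     & forall j, j \in T -> j \notin B -> f j <= f w]).
Proof.
move=> es sT sB sf; rewrite /farthest_prog exec_seq.
set s1 := exec (nassign _ _) s; have es1 : env s1 by apply: exec_env es.
pose P (i : nat) s' :=
  (nmem s' vf 0%N 0%N = 0%N /\ forall j : 'I_n, (j < i)%N -> j \in T -> j \in B) \/
  (nmem s' vf 0%N 0%N = 1%N /\ exists w : 'I_n, [/\ nmem s' vw 0%N 0%N = w, w \in T, w \notin B
     & forall j : 'I_n, (j < i)%N -> j \in T -> j \notin B -> f j <= f w]).
set s2 := exec _ s1; suff : P n s2.
  case=> [[f0 TB]|[f1 [w [wE wT wB wmax]]]]; [left|right]; split=> //.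
    by apply/fintype.subsetP => j; apply: TB.
  by exists w; split=> // j; apply: wmax.
apply: for_n => //; first by left.
move=> i s' s'i es' ss' Pi.
have sT' : isset s' vP T by apply: isset_same ss' _ _.
have sB' : isset s' vB B by apply: isset_same ss' _ _.
have sf' (j : 'I_n) : rmem s' rr j 0%N = f j by rewrite ss'.2 //; apply: sf.
rewrite exec_if; have -> : beval s' farthest_test = [&& i \in T, i \notin B
    & (nmem s' vf 0%N 0%N == 0%N) || (rmem s' rr (nmem s' vw 0 0) 0%N < f i)].
  rewrite /= s'i sT' sB' sf' -andbA negb_and negbK -leqNgt leqn0.
  by case: (i \in T) (i \in B) => [] [].
case: ifP => [/and3P[iT iB fi]|fi].
  right; split=> //; exists i; split=> // j; rewrite ltS_ord => /predU1P[->//|ji jT jB].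
  move: Pi => [[_ /(_ _ ji jT)]|[f1 [w [wE _ _ wmax]]]]; first by rewrite (negPf jB).
  move: fi; rewrite f1 wE sf' /= => /ltW fwi.
  exact: le_trans (wmax _ ji jT jB) fwi.
move: Pi => [[f0 TB]|[f1 [w [wE wT wB wmax]]]]; [left|right]; split=> //.
  move=> j; rewrite ltS_ord => /predU1P[->|/TB//] iT.
  by move: fi; rewrite iT f0 /= andbT => /negbFE.
exists w; split=> // j; rewrite ltS_ord => /predU1P[-> iT iB|]; last exact: wmax.
by move: fi; rewrite iT iB f1 wE sf' /= => /negbT; rewrite -leNgt.
Qed.

Lemma set_entry_spec (x i : nat) e s X (j : 'I_n) (b : bool) :
    isset s x X -> nmem s i 0%N 0%N = j -> neval s e = b ->
  isset (exec (set_entry x i e) s) x (if b then j |: X else X :\ j).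
Proof.
move=> sX sj se j' /=; rewrite /upd eqxx sj se andbT /= sX.
have -> : (val j' == val j) = (j' == j) by rewrite (inj_eq val_inj).
by case: ifP => [/eqP ->|j'j]; case: (b); rewrite !inE ?eqxx ?j'j.
Qed.

Lemma card_le_n X : (#|X| <= n)%N.
Proof. by rewrite -[leqRHS]card_ord max_card. Qed.

Lemma greedy_step_spec s T B : env s -> isset s vP T -> isset s vB B ->
    vol_greedy A T B -> (#|B| < #|T|)%N ->
  exists B', [/\ isset (exec greedy_step s) vB B', #|B'| = #|B|.+1 & vol_greedy A T B'].
Proof.
move=> es sT sB gB BT; rewrite /greedy_step 3!exec_seq.
set s1 := exec (copy_prog _ _) s; have ss1 : same _ _ s s1 := exec_same (copy_prog vX vB) s.
have es1 : env s1 by apply: exec_env es.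
have sX1 : isset s1 vX B by apply: copy_spec.
set s2 := exec resid_prog s1; have ss2 : same _ _ s1 s2 := exec_same resid_prog s1.
have es2 : env s2 by apply: exec_env es1.
have sr2 : forall j : 'I_n, rmem s2 rr j 0%N = resid B j := resid_prog_spec es1 sX1.
have sB2 : isset s2 vB B by apply: isset_same ss2 _ _ => //; apply: isset_same ss1 _ sB.
have sT2 : isset s2 vP T by apply: isset_same ss2 _ _ => //; apply: isset_same ss1 _ sT.
have ss3 := exec_same farthest_prog s2.
have := farthest_spec es2 sT2 sB2 sr2; set s3 := exec farthest_prog s2 in ss3 *.
case=> [[_ /subset_leq_card]|[f1 [w [wE wT wB wmax]]]]; first by rewrite leqNgt BT.
exists (w |: B); split; last exact: vol_greedyS.
  rewrite exec_ifT ?[beval _ _]/= ?f1 //; apply: (@set_entry_spec _ _ _ _ _ _ true) => //.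
  exact: isset_same ss3 _ sB2.
by rewrite cardsU1 wB.
Qed.

Lemma greedy_prog_spec s T b : env s -> isset s vP T -> nmem s vb 0%N 0%N = b ->
    (b <= #|T|)%N ->
  exists B, [/\ isset (exec greedy_prog s) vB B, #|B| = b & vol_greedy A T B].
Proof.
move=> es sT sb bT; rewrite /greedy_prog exec_seq.
set s1 := exec (setfor_prog _ _) s.
have ss1 : same _ _ s s1 := exec_same (setfor_prog vB (NLit 0)) s.
have es1 : env s1 by apply: exec_env es.
have sB1 : isset s1 vB finset.set0 by apply: setfor_spec => // j *; rewrite inE.
have sT1 : isset s1 vP T by apply: isset_same ss1 _ sT.
pose P q s' := exists B, [/\ isset s' vB B, #|B| = minn q b & vol_greedy A T B].
set s2 := exec _ s1; suff : P n s2.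
  by rewrite /P (minn_idPr _) // (leq_trans bT) // card_le_n.
apply: for_n => //.
  by exists finset.set0; split; rewrite ?min0n ?cards0 //; apply: vol_greedy0.
move=> q s' s'q es' ss' [B [sB cB gB]]; rewrite exec_if.
have sT' : isset s' vP T by apply: isset_same ss' _ sT1.
have -> : beval s' (NLt (scalar 25) (scalar vb)) = (q < b)%N.
  by rewrite /= s'q ss'.1 // ss1.1 // sb.
case: ifP => qb; last first.
  have bq : (b <= q)%N by rewrite leqNgt qb.
  by exists B; split=> //; rewrite cB (minn_idPr bq) (minn_idPr (leqW bq)).
have cBq : #|B| = q by rewrite cB; apply/minn_idPl/ltnW.
have [|B' [sB' cB' gB']] := greedy_step_spec es' sT' sB gB.
  by rewrite cBq (leq_trans qb).
by exists B'; split=> //; rewrite cB' cBq; apply/esym/minn_idPl.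
Qed.

Let eta := eps / 8.

Lemma loo_prog_spec s B (j : 'I_n) : env s -> isset s vB B -> nmem s 27%N 0%N 0%N = j ->
  let s' := exec loo_prog s in
  rmem s' rlo 0%N 0%N = resid (B :\ j) j /\
  forall i : 'I_n, rmem s' rr i 0%N = resid B i.
Proof.
move=> es sB sj; rewrite /loo_prog 5!exec_seq.
set s1 := exec (copy_prog _ _) s; have ss1 : same _ _ s s1 := exec_same (copy_prog vX vB) s.
have es1 : env s1 by apply: exec_env es.
have sX1 : isset s1 vX B by apply: copy_spec.
set s2 := exec (set_entry _ _ _) s1.
have ss2 : same _ _ s1 s2 := exec_same (set_entry vX 27 (NLit 0)) s1.
have es2 : env s2 by apply: exec_env es1.
have sX2 : isset s2 vX (B :\ j).
  by apply: (@set_entry_spec _ _ _ _ _ j false) => //; rewrite ss1.1.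
set s3 := exec resid_prog s2; have ss3 : same _ _ s2 s3 := exec_same resid_prog s2.
have es3 : env s3 by apply: exec_env es2.
have sr3 := resid_prog_spec es2 sX2 j.
set s4 := exec (rassign _ _) s3.
have ss4 : same _ _ s3 s4 := exec_same (rassign rlo (rentry rr 27)) s3.
have es4 : env s4 by apply: exec_env es3.
have lo4 : rmem s4 rlo 0%N 0%N = resid (B :\ j) j.
  rewrite /s4 /= /upd /= -sr3 -/s3; congr (rmem s3 rr _ _).
  by rewrite ss3.1 // ss2.1 // ss1.1.
set s5 := exec (copy_prog _ _) s4; have ss5 : same _ _ s4 s5 := exec_same (copy_prog vX vB) s4.
have es5 : env s5 by apply: exec_env es4.
have sB4 : isset s4 vB B.
  apply: isset_same ss4 _ _ => //; apply: isset_same ss3 _ _ => //.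
  by apply: isset_same ss2 _ _ => //; apply: isset_same ss1 _ sB.
have sX5 : isset s5 vX B by apply: copy_spec.
split; last exact: resid_prog_spec.
by rewrite (exec_same resid_prog s5).2 // ss5.2.
Qed.

Definition swappable T B (i j : 'I_n) : Prop :=
  [/\ i \in T, i \notin B, j \in B & (1 + eta) * resid (B :\ j) j < resid B i].

Definition swap_found T B s : Prop := nmem s vf 0%N 0%N = 1%N /\
  exists i j : 'I_n, [/\ nmem s vwi 0%N 0%N = i, nmem s vwj 0%N 0%N = j & swappable T B i j].

Lemma find_swap_spec s T B : env s -> isset s vP T -> isset s vB B ->
  let s' := exec find_swap_prog s in
  (nmem s' vf 0%N 0%N = 0%N /\ stable A eta T B) \/ swap_found T B s'.
Proof.
move=> es sT sB; rewrite /find_swap_prog exec_seq.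
set s1 := exec (nassign _ _) s; have es1 : env s1 by apply: exec_env es.
have sT1 : isset s1 vP T by [].
have sB1 : isset s1 vB B by [].
pose ok i j := i \in T -> i \notin B -> j \in B ->
  resid B i <= (1 + eta) * resid (B :\ j) j.
pose P (j : nat) s' :=
  (nmem s' vf 0%N 0%N = 0%N /\ forall i j' : 'I_n, (j' < j)%N -> ok i j') \/ swap_found T B s'.
set s2 := exec _ s1; suff : P n s2.
  case=> [[f0 okP]|]; [left|by right]; split=> // i j iT iB jB.
  exact: (okP i j).
apply: for_n => //; first by left.
move=> j s' s'j es' ss' Pj.
have sT' : isset s' vP T by apply: isset_same ss' _ sT1.
have sB' : isset s' vB B by apply: isset_same ss' _ sB1.
rewrite exec_if; have -> : beval s' (NLt (NLit 0) (entry vB 27)) = (j \in B).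
  by rewrite /= s'j sB' lt0b.
case: (boolP (j \in B)) => jB; last first.
  case: Pj => [[f0 okP]|found]; [left|by right]; split=> // i j'.
  by rewrite ltS_ord => /predU1P[-> ? ?|]; [rewrite (negPf jB)|exact: okP].
rewrite exec_seq.
have [] := loo_prog_spec es' sB' s'j; set s3 := exec loo_prog s' => lo3 sr3.
have ss3 : same _ _ s' s3 := exec_same loo_prog s'.
have es3 : env s3 by apply: exec_env es'.
pose Q (i : nat) s'' := (nmem s'' vf 0%N 0%N = 0%N /\
    (forall i' j' : 'I_n, (j' < j)%N -> ok i' j') /\
    forall i' : 'I_n, (i' < i)%N -> ok i' j) \/ swap_found T B s''.
suff : Q n (exec find_swap_inner s3).
  case=> [[f0 [okP okj]]|]; [left|by right]; split=> // i j'.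
  by rewrite ltS_ord => /predU1P[->|]; [exact: okj|exact: okP].
apply: for_n => //.
  case: Pj => [[f0 okP]|[f1 [i [j0 [iE jE sw]]]]]; [left|right].
    by split; first by rewrite ss3.1.
  by split; [rewrite ss3.1|exists i, j0; split=> //; rewrite ss3.1].
move=> i s'' s''i es'' ss'' Qi.
have sT'' : isset s'' vP T by apply: isset_same ss'' _ _ => //; apply: isset_same ss3 _ sT'.
have sB'' : isset s'' vB B by apply: isset_same ss'' _ _ => //; apply: isset_same ss3 _ sB'.
rewrite exec_if; have -> : beval s'' swap_test
    = [&& i \in T, i \notin B & (1 + eta) * resid (B :\ j) j < resid B i].
  have [_ [_ eE _]] := es''.
  rewrite /= s''i sT'' sB'' eE (ss''.2 rr) // (ss''.2 rlo) // lo3 sr3 -andbA.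
  by case: (i \in T) (i \in B) => [] [].
case: ifP => [/and3P[iT iB lt_ij]|nsw].
  have s''j : nmem s'' 27%N 0%N 0%N = j by rewrite ss''.1 // ss3.1.
  by right; split=> //; exists i, j.
case: Qi => [[f0 [okP okj]]|]; [left|by right]; split=> //; split=> // i'.
rewrite ltS_ord => /predU1P[-> iT iB _|]; last exact: okj.
by move: nsw; rewrite iT iB /= ltNge => /negbFE.
Qed.

Lemma swap_step_spec s T B : env s -> isset s vP T -> isset s vB B ->
  exists2 B', isset (exec swap_step s) vB B' &
    (B' = B /\ stable A eta T B) \/
    exists i j, swappable T B i j /\ B' = i |: B :\ j.
Proof.
move=> es sT sB; rewrite /swap_step exec_seq.
have := find_swap_spec es sT sB; set s1 := exec find_swap_prog s.
have ss1 : same _ _ s s1 := exec_same find_swap_prog s.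
have sB1 : isset s1 vB B by apply: isset_same ss1 _ sB.
case=> [[f0 st]|[f1 [i [j [iE jE sw]]]]].
  by rewrite exec_ifF ?[beval _ _]/= ?f0 //; exists B => //; left.
rewrite exec_ifT ?[beval _ _]/= ?f1 // exec_seq.
exists (i |: B :\ j); last by right; exists i, j.
apply: (@set_entry_spec _ _ _ _ _ _ true) => //.
exact: (@set_entry_spec _ _ _ _ _ _ false).
Qed.

Lemma for_n_count x p s (I : nat -> state R -> Prop) c e :
    loop_ok x p -> env s -> (forall c s v, I c s -> I c (setn s x v)) ->
    (forall c s', env s' -> same (x :: wnat p) (wreal p) s s' -> I c s' ->
       I (c + e)%N (exec p s')) ->
  I c s -> I (c + n * e)%N (exec (PFor 1 x p) s).
Proof.
move=> okp es Ix IS Ic; pose P j s' := I (c + j * e)%N s'.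
suff : P n (exec (PFor 1 x p) s) by [].
apply: for_n => // [j s' v||j s' s'j es' ss' Pj]; first exact: Ix.
  by rewrite /P addn0.
by rewrite /P mulSn addnCA addnC; apply: IS.
Qed.

(** After [c] steps the set is stable or its volume is at least [(1 + eta) ^+ c] times the initial
    one. At the end the second alternative would contradict the near-maximality of the greedy
    set. *)
Lemma local_search_spec s T B0 : 0 < eps -> (0 < n)%N -> 2 <= eta * n%:R ->
    env s -> isset s vP T -> isset s vB B0 -> vol_greedy A T B0 ->
  exists B, [/\ isset (exec local_search_prog s) vB B, B \subset T, #|B| = #|B0| &
    stable A eta T B].
Proof.
move=> e0 n0 en es sT sB gB; have eta0 : 0 <= eta by rewrite /eta divr_ge0 // ltW.
pose I c s' := exists B, [/\ isset s' vB B, B \subset T, #|B| = #|B0| &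
  stable A eta T B \/ 0 < vol A B0 /\ (1 + eta) ^+ c * vol A B0 <= vol A B].
have sT' wn wr s' : same wn wr s s' -> vP \notin wn -> isset s' vP T.
  by move=> ss' ?; apply: isset_same ss' _ sT.
have IS c s' : env s' -> isset s' vP T -> I c s' -> I (c + 1)%N (exec swap_step s').
  move=> es' sT'' [B [sB' BT cB volB]].
  have [B' sB'' BB'] := swap_step_spec es' sT'' sB'.
  exists B'; case: BB' sB'' => [[-> st]|[i [j [[iT iB jB ij] ->]]]] sB''.
    by split=> //; left.
  split.
  - by [].
  - by rewrite finset.subUset finset.sub1set iT (fintype.subset_trans _ BT) ?finset.subD1set.
  - rewrite cardsU1 !inE (negPf iB) andbF add1n -cB.
    by have := cardsD1 j B; rewrite jB add1n => ->.
  right; case: volB => [st|[v0 volB]].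
    by have := st i j iT iB jB; rewrite leNgt ij.
  split=> //; rewrite addn1 exprS -mulrA.
  apply: le_trans (vol_swap iB jB (ltW ij)); apply: ler_wpM2l => //.
  by rewrite addr_ge0.
have I0 : I 0%N s.
  exists B0; have [B0T _ _] := gB; split=> //.
  by case: (vol_greedy_stable eta0 gB) => [|v0]; [left|right; rewrite expr0 mul1r].
have : I (0 + n * (n * (n * 1)))%N (exec local_search_prog s).
  apply: for_n_count => // c s1 es1 ss1 Ic; apply: for_n_count => // c' s2 es2 ss2 Ic'.
  apply: for_n_count => // c'' s3 es3 ss3; apply: IS => //.
  apply: isset_same ss3 _ _ => //; apply: isset_same ss2 _ _ => //.
  exact: sT' ss1 _.
rewrite add0n muln1 => -[B [sB' BT cB volB]]; exists B; split=> //.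
case: volB => // -[v0]; rewrite leNgt => /negP[].
have [_ maxB _] := gB; have := maxB B BT cB => /le_lt_trans; apply.
rewrite ltr_pM2r //; apply: fact_lt_growth => //.
exact: card_le_n.
Qed.

Lemma max_spec s T (f : 'I_n -> R) : env s -> isset s vP T ->
    (forall j : 'I_n, rmem s rr j 0%N = f j) -> (forall j, 0 <= f j) ->
  let nu := rmem (exec max_prog s) rnu 0%N 0%N in
  (forall j, j \in T -> f j <= nu) /\ (nu = 0 \/ exists2 j, j \in T & nu = f j).
Proof.
move=> es sT sf f0; rewrite /max_prog exec_seq.
set s1 := exec (rassign _ _) s; have es1 : env s1 by apply: exec_env es.
pose P (i : nat) s' := let nu := rmem s' rnu 0%N 0%N in
  (forall j : 'I_n, (j < i)%N -> j \in T -> f j <= nu) /\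
  (nu = 0 \/ exists2 j, j \in T & nu = f j).
set s2 := exec _ s1; suff : P n s2 by case=> H ?; split=> // j; apply: H.
apply: for_n => //; first by split=> //; left.
move=> i s' s'i es' ss' [Pi nuE]; rewrite exec_if.
have sT' : isset s' vP T by apply: isset_same ss' _ _.
have sf' (j : 'I_n) : rmem s' rr j 0%N = f j by rewrite ss'.2 //; apply: sf.
rewrite [beval _ _]/= s'i sT' sf' lt0b; case: ifP => [/andP[iT lt_i]|].
  rewrite /P /= /upd /= s'i sf'; split; last by right; exists i.
  move=> j; rewrite ltS_ord => /predU1P[->//|ji jT].
  exact: le_trans (Pi j ji jT) (ltW lt_i).
move=> ni; split=> // j; rewrite ltS_ord => /predU1P[-> iT|]; last exact: Pi.
by move: ni; rewrite iT /= => /negbT; rewrite -leNgt.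
Qed.

Let kappa := eps / 16.

Lemma block_prog_spec s T b : 0 < eps -> (0 < n)%N -> 2 <= eta * n%:R -> env s ->
    isset s vP T -> nmem s vb 0%N 0%N = b -> (b <= #|T|)%N ->
  let s' := exec block_prog s in
  exists B, [/\ isset s' vB B, isset s' vP (T :\: B), B \subset T, #|B| = b & stable A eta T B] /\
    let nu := rmem s' rnu 0%N 0%N in
    (forall i, i \in T -> i \notin B -> resid B i <= nu) /\
    (nu = 0 \/ exists2 i, i \in T :\: B & nu = resid B i).
Proof.
move=> e0 n0 en es sT sb bT; rewrite /block_prog 5!exec_seq.
set s1 := exec greedy_prog s; have ss1 : same _ _ s s1 := exec_same greedy_prog s.
have es1 : env s1 by apply: exec_env es.
have [B0 [sB1 cB0 gB0]] := greedy_prog_spec es sT sb bT; rewrite -/s1 in sB1.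
have sT1 : isset s1 vP T by apply: isset_same ss1 _ sT.
set s2 := exec local_search_prog s1.
have ss2 : same _ _ s1 s2 := exec_same local_search_prog s1.
have es2 : env s2 by apply: exec_env es1.
have [B [sB2 BT cB st]] := local_search_spec e0 n0 en es1 sT1 sB1 gB0; rewrite -/s2 in sB2.
have sT2 : isset s2 vP T by apply: isset_same ss2 _ sT1.
set s3 := exec (copy_prog _ _) s2; have ss3 : same _ _ s2 s3 := exec_same (copy_prog vX vB) s2.
have es3 : env s3 by apply: exec_env es2.
have sX3 : isset s3 vX B by apply: copy_spec.
set s4 := exec resid_prog s3; have ss4 : same _ _ s3 s4 := exec_same resid_prog s3.
have es4 : env s4 by apply: exec_env es3.
have sr4 := resid_prog_spec es3 sX3; rewrite -/s4 in sr4.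
have sB4 : isset s4 vB B by apply: isset_same ss4 _ _ => //; apply: isset_same ss3 _ sB2.
have sT4 : isset s4 vP T by apply: isset_same ss4 _ _ => //; apply: isset_same ss3 _ sT2.
set diff := setfor_prog _ _; set s5 := exec diff s4.
have ss5 : same _ _ s4 s5 := exec_same diff s4.
have es5 : env s5 by apply: exec_env es4.
have sT5 : isset s5 vP (T :\: B).
  apply: setfor_spec => // j s' s'j ss' s'x /=.
  by rewrite s'j s'x ss'.1 // sT4 sB4 inE; case: (j \in T) (j \in B) => [] [].
have sr5 (j : 'I_n) : rmem s5 rr j 0%N = resid B j by rewrite ss5.2 // sr4.
set s6 := exec max_prog s5; have ss6 : same _ _ s5 s6 := exec_same max_prog s5.
have [max1 max2] := max_spec es5 sT5 sr5 (fun j => dist2_ge0 _ _).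
exists B; split; last first.
  by split=> // i iT iB; apply: max1; rewrite inE iB.
split=> //; last by rewrite cB.
  by apply: isset_same ss6 _ _ => //; apply: isset_same ss5 _ sB4.
exact: isset_same ss6 _ sT5.
Qed.

Lemma blocks_prog_spec s T (b u p : nat) : 0 < eps -> eps <= 1 -> (0 < n)%N -> 2 <= eta * n%:R ->
    env s -> isset s vT T -> nmem s vb 0%N 0%N = b -> nmem s vp 0%N 0%N = p ->
    (p <= n)%N -> (p * b <= #|T|)%N -> (0 < p)%N -> (0 < u)%N -> k%:R <= kappa * u%:R ->
  let s' := exec blocks_prog s in
  exists (T' Bb Tb : {set 'I_n}), [/\ isset s' vBb Bb, isset s' vTb Tb &
    block_inv A k eta kappa T b u p T' Bb Tb (rmem s' rnub 0%N 0%N)].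
Proof.
move=> e0 e1 n0 en es sT sb sp pn pbT p0 u0 ku; rewrite /blocks_prog exec_seq.
have eta0 : 0 <= eta by rewrite /eta divr_ge0 // ltW.
have kap0 : 0 < kappa by rewrite /kappa divr_gt0.
have kap1 : 16 * kappa <= 1 by rewrite /kappa mulrC divfK.
set s1 := exec (copy_prog _ _) s; have ss1 : same _ _ s s1 := exec_same (copy_prog vP vT) s.
have es1 : env s1 by apply: exec_env es.
have sT1 : isset s1 vP T by apply: copy_spec.
(* Because of the guard, [minn l p] blocks have been taken after [l] iterations; before the first
   block the arrays for the best one carry no information. *)
pose P l s' := exists (T' Bb Tb : {set 'I_n}), [/\ isset s' vP T',
  (0 < minn l p)%N -> isset s' vBb Bb /\ isset s' vTb Tb &
  block_inv A k eta kappa T b u (minn l p) T' Bb Tb (rmem s' rnub 0%N 0%N)].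
suff : P n (exec (PFor 1 32 (PIf (NLt (scalar 32) (scalar vp)) (block_prog ;; select_prog)
                                 PSkip)) s1).
  by case=> T' [Bb [Tb]]; rewrite (minn_idPr pn) => -[_ /(_ p0)[? ?] ?]; exists T', Bb, Tb.
apply: for_n => //.
  by exists T, finset.set0, finset.set0; rewrite min0n; split=> //; apply: block_inv0.
move=> l s' s'l es' ss' [T' [Bb [Tb [sT' sbest binv]]]].
have sb' : nmem s' vb 0%N 0%N = b by rewrite (ss'.1 vb isT) (ss1.1 vb isT).
have sp' : nmem s' vp 0%N 0%N = p by rewrite (ss'.1 vp isT) (ss1.1 vp isT).
have -> : exec (PIf (NLt (scalar 32) (scalar vp)) (block_prog ;; select_prog) PSkip) s'
    = if (l < p)%N then exec select_prog (exec block_prog s') else s'.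
  by rewrite exec_if [beval _ _]/= s'l sp' exec_seq.
case: ifP => lp; last first.
  have pl : (p <= l)%N by rewrite leqNgt lp.
  exists T', Bb, Tb; move: sbest binv.
  by rewrite (minn_idPr pl) (minn_idPr (leqW pl)).
rewrite (minn_idPl (ltnW lp)) in sbest binv.
have [_ cT' _ _] := binv.
have lbT : (l.+1 * b <= #|T|)%N by apply: leq_trans pbT; rewrite leq_mul2r lp orbT.
have bT' : (b <= #|T'|)%N by rewrite cT' leq_subRL ?(leq_trans _ lbT) // ?mulSn 1?addnC // leq_addr.
have ss2 : same _ _ s' _ := exec_same block_prog s'.
have es2 : env (exec block_prog s') by apply: exec_env es'.
have [B [[sB sTB BT' cB st] [nuB nuE]]] := block_prog_spec e0 n0 en es' sT' sb' bT'.
set s2 := exec block_prog s' in ss2 es2 sB sTB nuB nuE *; clearbody s2.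
have binv' := block_invS eta0 kap0 kap1 binv u0 ku lbT BT' cB st nuB nuE.
set better := (_ || _) in binv'.
have bE : beval s2 select_test = better.
  by rewrite /= (ss2.1 32%N isT) s'l (ss2.2 rnub isT) negb_and negbK -leqNgt leqn0.
rewrite exec_if bE.
rewrite /P (minn_idPl lp); exists (T' :\: B), (if better then B else Bb),
  (if better then T' :\: B else Tb).
case: ifP binv' => bt binv'; last first.
  split=> // [_|].
    have [|sBb sTb] := sbest; first by move: bt; rewrite /better lt0n; case: eqP.
    by split; apply: isset_same ss2 _ _.
  by rewrite ss2.2.
rewrite 2!exec_seq.
set s3 := exec (rassign _ _) s2; have es3 : env s3 by apply: exec_env es2.
have sB3 : isset s3 vB B by [].
have sT3 : isset s3 vP (T' :\: B) by [].
set s4 := exec (copy_prog _ _) s3; have ss4 : same _ _ s3 s4 := exec_same (copy_prog vBb vB) s3.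
have es4 : env s4 by apply: exec_env es3.
have sB4 : isset s4 vBb B by apply: copy_spec.
have sT4 : isset s4 vP (T' :\: B) by apply: isset_same ss4 _ sT3.
have ss5 := exec_same (copy_prog vTb vP) s4.
split=> //; first exact: isset_same ss5 _ sT4.
  by split; [exact: isset_same ss5 _ sB4|apply: copy_spec].
by rewrite ss5.2 // ss4.2.
Qed.

Lemma remove_spec s T (Tb : {set 'I_n}) (g : nat) : env s -> isset s vT T -> isset s vTb Tb ->
    nmem s vg 0%N 0%N = g -> (g <= #|Tb|)%N ->
  exists G : {set 'I_n}, [/\ G \subset Tb, #|G| = g & isset (exec remove_prog s) vT (T :\: G)].
Proof.
move=> es sT sTb sg gTb; rewrite /remove_prog exec_seq.
set s1 := exec (nassign _ _) s; have es1 : env s1 by apply: exec_env es.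
pose Ti (i : nat) := [set j in Tb | (j < i)%N].
(* The loop removes the first [g] members of [Tb]. *)
pose P (i : nat) s' := exists G : {set 'I_n}, [/\ G \subset Ti i, #|G| = minn #|Ti i| g,
  nmem s' vc 0%N 0%N = #|G| & isset s' vT (T :\: G)].
set s2 := exec _ s1; suff : P n s2.
  case=> G [GT cG _ sG]; exists G; split=> //.
    by apply: fintype.subset_trans GT _; apply/fintype.subsetP => j; rewrite inE => /andP[].
  rewrite cG; apply/minn_idPr; apply: leq_trans gTb _; apply: subset_leq_card.
  by apply/fintype.subsetP => j jT; rewrite inE jT ltn_ord.
have T0 : Ti 0%N = finset.set0 by apply/setP => j; rewrite !inE ltn0 andbF.
have TS (i : 'I_n) : Ti i.+1 = if i \in Tb then i |: Ti i else Ti i.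
  apply/setP => j; case: ifP => iTb; rewrite !inE ltS_ord.
    by case: (eqVneq j i) => [->|] //=; rewrite iTb.
  by case: (eqVneq j i) => [->|] //=; rewrite iTb.
have iTi (i : 'I_n) : i \notin Ti i by rewrite inE ltnn andbF.
apply: for_n => //.
  exists finset.set0; rewrite T0 cards0 min0n; split=> //.
  by rewrite finset.setD0.
move=> i s' s'i es' ss' [G [GT cG sc sG]].
have sTb' : isset s' vTb Tb by apply: isset_same ss' _ _.
have sg' : nmem s' vg 0%N 0%N = g by rewrite ss'.1.
rewrite exec_if [beval _ _]/= s'i sTb' sc sg' lt0b.
case: ifP => [/andP[iTb Gg]|nG]; last first.
  exists G; split=> //; rewrite TS; case: ifP nG => [iTb|//] /= Gg.
    by apply: fintype.subset_trans GT _; apply: finset.subsetUr.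
  rewrite cardsU1 iTi add1n cG; move: Gg; rewrite cG => /negbT; rewrite -leqNgt => gm.
  have gT : (g <= #|Ti i|)%N by apply: leq_trans gm (geq_minl _ _).
  by rewrite (minn_idPr gT) (minn_idPr (leqW gT)).
have iG : i \notin G by apply: contra (iTi i); apply: (fintype.subsetP GT).
have cGi : #|i |: G| = #|G|.+1 by rewrite cardsU1 iG.
have GTi : #|G| = #|Ti i|.
  by move: Gg; rewrite cG; case: (leqP #|Ti i| g) => // gT; rewrite ltnn.
rewrite exec_seq; exists (i |: G); split.
- by rewrite TS iTb finset.setUS.
- by rewrite TS iTb cGi cardsU1 iTi add1n -GTi (minn_idPl _).
- by rewrite cGi -sc -[RHS]addn1.
have := set_entry_spec (b := false) (e := NLit 0) sG s'i erefl.
rewrite (_ : T :\: (i |: G) = (T :\: G) :\ i) //.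
by apply/setP => j; rewrite !inE negb_or -andbA.
Qed.

Lemma g_prog_spec s (p : nat) : env s -> nmem s vp 0%N 0%N = p -> (p <= n)%N ->
  nmem (exec g_prog s) vg 0%N 0%N = (p * nmem s vu 0%N 0%N)%N.
Proof.
move=> es sp pn; rewrite /g_prog exec_seq.
set s1 := exec (nassign _ _) s; have es1 : env s1 by apply: exec_env es.
pose P (i : nat) s' := nmem s' vg 0%N 0%N = (minn i p * nmem s vu 0%N 0%N)%N.
set s2 := exec _ s1; suff : P n s2 by rewrite /P (minn_idPr pn).
apply: for_n => //; first by rewrite /P min0n.
move=> i s' s'i es' ss' Pi; rewrite exec_if [beval _ _]/= s'i (ss'.1 vp) // [nmem s1 vp _ _]sp.
rewrite /P; case: ifP => ip.
  rewrite /= upd_eq Pi (ss'.1 vu) // (minn_idPl (ltnW ip)) (minn_idPl ip).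
  by rewrite mulSn addnC.
have pi : (p <= i)%N by rewrite leqNgt ip.
by rewrite [LHS]Pi (minn_idPr pi) (minn_idPr (leqW pi)).
Qed.

(** * Parameters of a round, the size invariant and the complete run *)

Section Correctness.
Hypotheses (k_gt0 : (0 < k)%N) (m_gt0 : (0 < m)%N).
Hypotheses (eps_gt0 : 0 < eps) (eps_le1 : eps <= 1).
Hypotheses (delta_gt0 : 0 < delta) (delta_le1 : delta <= 1).

Let eta_ge0 : 0 <= eta. Proof. by rewrite /eta divr_ge0 // ltW. Qed.
Let kappa_gt0 : 0 < kappa. Proof. by rewrite /kappa divr_gt0. Qed.
Let kappa_le : 16 * kappa <= 1. Proof. by rewrite /kappa mulrC divfK. Qed.
Let epsE : eps = 16 * kappa. Proof. by rewrite /kappa mulrC divfK. Qed.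

Definition u_test (u : nat) : bool := u%:R * eps < 16 * k%:R.

(** This describes the ceiling of [k / kappa], cut off at [n]. *)
Definition u_spec (u : nat) : Prop :=
  [/\ (u <= n)%N, forall u', (u' < u)%N -> u_test u' & u = n \/ ~~ u_test u].

Lemma u_prog_spec s : env s -> u_spec (nmem (exec u_prog s) vu 0%N 0%N).
Proof.
move=> es; apply: (@search_spec vu) => // s' ss' /=.
have [[_ _ e2 _] [_ e4 _]] := es.
by rewrite (ss'.1 2%N isT) (ss'.2 1%N isT) e2 e4.
Qed.

Lemma u_bounds u : (0 < n)%N -> u_spec u -> (0 < u)%N /\ u%:R <= k%:R / kappa + 1.
Proof.
move=> n0 [un u_lt u_stop]; have k1 : 1 <= k%:R :> R by rewrite ler1n.
have u0 : (0 < u)%N.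
  rewrite lt0n; apply/eqP => uz; case: u_stop; rewrite uz.
    by move=> nz; rewrite -nz in n0.
  by rewrite /u_test mul0r mulr_gt0 ?ltr0n.
split=> //; have := u_lt u.-1; rewrite prednK // leqnn => /(_ isT).
rewrite /u_test epsE => lt_u; rewrite -lerBlDr ler_pdivlMr //.
have -> : u%:R = u.-1%:R + 1 :> R by rewrite natr1 prednK.
by rewrite addrK; nra.
Qed.

(** The last clause holds because a positive [p] gives [u <= p * u <= kappa * (t - m)], so [u] is
    below [n] and was not cut off; moreover [kappa * n] is then at least 1, and [eta] is
    [2 * kappa]. *)
Lemma p_prog_spec s t u : env s -> nmem s vt 0%N 0%N = t -> nmem s vu 0%N 0%N = u ->
    u_spec u -> (t <= n)%N -> (0 < t)%N ->
  let p := nmem (exec p_prog s) vp 0%N 0%N in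
  [/\ (p <= n)%N, (0 < p)%N -> (p * u)%:R <= kappa * (t - m)%:R,
      kappa * (t - m)%:R < (p%:R + 1) * u%:R &
      (0 < p)%N -> k%:R <= kappa * u%:R /\ 2 <= eta * n%:R].
Proof.
move=> es st su us tn t0; have n0 : (0 < n)%N := leq_trans t0 tn.
have [u0 _] := u_bounds n0 us; have u1 : 1 <= u%:R :> R by rewrite ler1n.
have [[_ _ _ e3] [_ e4 _]] := es.
pose c (p : nat) := ~~ ((t - m)%:R * eps < 16 * ((p + 1)%:R * u%:R)).
have cP s' : same [:: 34%N; vp] [::] s s' -> beval s' p_test = c (nmem s' vp 0%N 0%N).
  move=> ss' /=; rewrite (ss'.1 vt isT) (ss'.1 3%N isT) (ss'.2 1%N isT) (ss'.1 vu isT).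
  by rewrite st su e3 e4.
have [] := @search_spec vp p_test s c es isT isT cP; rewrite -[search_prog _ _]/p_prog.
move: (nmem _ vp _ _) => p pn p_lt p_stop /=.
have xn : (t - m)%:R <= n%:R :> R by rewrite ler_nat (leq_trans (leq_subr _ _)).
have x0 : 0 <= (t - m)%:R :> R by [].
have pu : (0 < p)%N -> (p * u)%:R <= kappa * (t - m)%:R.
  move=> p0; have := p_lt p.-1; rewrite prednK // leqnn => /(_ isT).
  rewrite /c -leNgt addn1 prednK // natrM epsE; nra.
split=> //.
  case: p_stop => [->|]; last first.
    by rewrite /c negbK natrD epsE; nra.
  by have := kappa_le; have := kappa_gt0; nra.
move=> p0; have := pu p0; rewrite natrM => pu'.
have p1 : 1 <= p%:R :> R by rewrite ler1n.
have n1 : 1 <= n%:R :> R by rewrite ler1n.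
have k1 : 1 <= k%:R :> R by rewrite ler1n.
have kx : 16 * (kappa * (t - m)%:R) <= n%:R.
  by have := kappa_le; have := kappa_gt0; nra.
have ku : k%:R <= kappa * u%:R.
  case: us => _ _ [un|]; last by rewrite /u_test -leNgt epsE; nra.
  have : kappa * (t - m)%:R < p%:R * n%:R by nra.
  by rewrite ltNge -un pu'.
split=> //; have un : u%:R <= n%:R :> R by rewrite ler_nat; case: us.
have -> : eta = 2 * kappa by rewrite /eta epsE; field.
by have := kappa_gt0; nra.
Qed.

Lemma b_prog_spec s (t g p : nat) : env s -> nmem s vt 0%N 0%N = t -> nmem s vg 0%N 0%N = g ->
    nmem s vp 0%N 0%N = p -> (0 < p)%N -> (t <= n)%N -> (g <= t)%N ->
  let b := nmem (exec b_prog s) vb 0%N 0%N in (p * b <= t - g)%N /\ (t - p * b < g + p)%N.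
Proof.
move=> es st sg sp p0 tn gt.
pose c (b : nat) := ~~ ((t - g)%:R < (b + 1)%:R * p%:R :> R).
have cP s' : same [:: 34%N; vb] [::] s s' -> beval s' b_test = c (nmem s' vb 0%N 0%N).
  move=> ss' /=; rewrite (ss'.1 vt isT) (ss'.1 vg isT) (ss'.1 vp isT).
  by rewrite st sg sp.
have [] := @search_spec vb b_test s c es isT isT cP; rewrite -[search_prog _ _]/b_prog.
move: (nmem _ vb _ _) => b bn b_lt b_stop /=.
have cE b' : c b' = ((b' + 1) * p <= t - g)%N by rewrite /c -natrM ltr_nat -leqNgt.
have bp : (b * p <= t - g)%N.
  case: (posnP b) => [->//|b0]; have := b_lt b.-1; rewrite prednK // leqnn => /(_ isT).
  by rewrite cE addn1 prednK.
have bp' : (t - g < (b + 1) * p)%N.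
  case: b_stop => [->|]; last by rewrite cE -ltnNge.
  by apply: (@leq_trans (n + 1)); rewrite ?leq_pmulr // addn1 ltnS (leq_trans (leq_subr _ _)).
split; first by rewrite mulnC.
by move: bp bp' gt; rewrite (mulnC p); clear; rewrite mulnDl mul1n; set v := (b * p)%N; lia.
Qed.

(** The 18 is 16 for the blocks of all rounds ([psi_le_budget]) plus 2 for the columns added at the
    end ([last_size_le]). *)
Definition budget : R := 18 * k%:R / kappa ^+ 3 * (ln (n%:R / m%:R) + 2 / delta).

(** Three situations: there is nothing to do from the start; rounds are under way and the sizes
    telescope; or the last active columns have been chosen. In the second, the factor 2 leaves room
    for one more round: it starts with [#|T| - m] above [delta * m] and removes at most a [kappa]
    fraction of that. *)
Definition size_inv T S : Prop :=
  (n%:R <= (1 + delta) * m%:R /\ S = finset.set0) \/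
  (1 + delta) * m%:R < n%:R /\
  ((#|S|%:R <= 8 * k%:R / kappa ^+ 3
       * (psi m%:R (n%:R - m%:R) - psi m%:R (#|T|%:R - m%:R)) /\
    delta * m%:R <= 2 * (#|T|%:R - m%:R)) \/
   (T = finset.set0 /\ #|S|%:R <= budget)).

Let m0 : 0 < m%:R :> R. Proof. by rewrite ltr0n. Qed.

Lemma psi_le_budget T S : (1 + delta) * m%:R < n%:R ->
    #|S|%:R <= 8 * k%:R / kappa ^+ 3
       * (psi m%:R (n%:R - m%:R) - psi m%:R (#|T|%:R - m%:R)) ->
    delta * m%:R <= 2 * (#|T|%:R - m%:R) ->
  #|S|%:R <= 16 * k%:R / kappa ^+ 3 * (ln (n%:R / m%:R) + 2 / delta).
Proof.
move=> mn Sle dT; apply: le_trans Sle _.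
have -> : 16 * k%:R / kappa ^+ 3 * (ln (n%:R / m%:R) + 2 / delta)
  = 8 * k%:R / kappa ^+ 3 * (2 * (ln (n%:R / m%:R) + 2 / delta)).
  by move: (ln _ + _) => L; field; rewrite gt_eqF.
apply: ler_wpM2l; first by rewrite divr_ge0 ?exprn_ge0 ?mulr_ge0 ?ler0n // ltW.
apply: (psi_total m0 delta_gt0) => //.
  by have := m0; have := delta_gt0; nra.
have : #|T|%:R <= n%:R :> R by rewrite ler_nat card_le_n.
by have := m0; lra.
Qed.

Let log_ge0 : (1 + delta) * m%:R < n%:R -> 0 <= ln (n%:R / m%:R : R).
Proof.
move=> mn; apply: ln_ge0; rewrite ler_pdivlMr // mul1r.
by have := m0; have := delta_gt0; nra.
Qed.

Lemma size_inv_budget T S : size_inv T S ->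
  S = finset.set0 \/ (m <= n)%N /\ #|S|%:R <= budget.
Proof.
case=> [[_ ->]|[mn Sle]]; [by left|right].
split.
  by rewrite -(ler_nat R); have := m0; have := delta_gt0; nra.
case: Sle => [[Sle dT]|[]//]; apply: le_trans (psi_le_budget mn Sle dT) _.
apply: ler_wpM2r; first by rewrite addr_ge0 ?log_ge0 // divr_ge0 // ltW.
apply: ler_wpM2r; first by rewrite invr_ge0 exprn_ge0 // ltW.
by apply: ler_wpM2r => //; lra.
Qed.

Implicit Types (G Bb Tb : {set 'I_n}) (pi : 'I_n -> R).

Lemma size_inv_round T S Bb G (u p b : nat) :
    size_inv T S -> (1 + delta) * m%:R < #|T|%:R -> G \subset T -> #|G| = (p * u)%N ->
    (#|Bb| <= b)%N -> (p * b <= #|T| - p * u)%N -> (0 < p)%N -> (0 < u)%N ->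
    u%:R <= k%:R / kappa + 1 -> (p * u)%:R <= kappa * (#|T| - m)%:R ->
    kappa * (#|T| - m)%:R < (p%:R + 1) * u%:R ->
  size_inv (T :\: G) (S :|: Bb).
Proof.
move=> inv mT GT cG cB pb p0 u0 uk pu pu1.
have kap0 := kappa_gt0; have kap1 := kappa_le; have mm := m0; have d0 := delta_gt0.
have mT' : (m <= #|T|)%N by rewrite -(ler_nat R); nra.
rewrite natrB // in pu pu1; set x := #|T|%:R - m%:R in pu pu1.
have x0 : delta * m%:R < x by rewrite /x; lra.
have x1 : 0 < x by nra.
have Tn : #|T|%:R <= n%:R :> R by rewrite ler_nat card_le_n.
have cTG : #|T :\: G|%:R = #|T|%:R - (p * u)%:R :> R.
  by rewrite cardsD (finset.setIidPr GT) cG natrB // -cG subset_leq_card.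
case: inv => [[nm _]|[mn [[Sle dT]|[T0 _]]]].
- by move: nm; rewrite leNgt (lt_le_trans mT Tn).
- right; split=> //; left; rewrite cTG.
  have -> : #|T|%:R - (p * u)%:R - m%:R = x - p%:R * u%:R by rewrite /x natrM; ring.
  split; last by move: pu; rewrite natrM; nra.
  apply: (@le_trans _ _ (#|S|%:R + b%:R)).
    by rewrite -natrD ler_nat (leq_trans (leq_card_setU _ _)) // leq_add2l.
  have : b%:R <= 8 * k%:R / kappa ^+ 3 * (psi m%:R x - psi m%:R (x - p%:R * u%:R)).
    apply: block_size_le => //; rewrite -?natrM //.
    - by lra.
    - by apply: le_lt_trans pu _; nra.
    - have -> : x + m%:R = #|T|%:R by rewrite /x subrK.
      by rewrite ler_nat mulnC (leq_trans pb) // leq_subr.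
  by move=> /(lerD Sle)/le_trans; apply; rewrite -/x -mulrDr addrA subrK.
by move: mT; rewrite T0 cards0; nra.
Qed.

Lemma size_inv_finish T S (u : nat) :
    size_inv T S -> (1 + delta) * m%:R < #|T|%:R ->
    u%:R <= k%:R / kappa + 1 -> kappa * (#|T| - m)%:R <= u%:R ->
  size_inv finset.set0 (S :|: T).
Proof.
move=> inv mT uk ku.
have kap0 := kappa_gt0; have kap1 := kappa_le; have mm := m0; have d0 := delta_gt0.
have d1 := delta_le1.
have mT' : (m <= #|T|)%N by rewrite -(ler_nat R); nra.
rewrite natrB // in ku; set x := #|T|%:R - m%:R in ku.
have Tn : #|T|%:R <= n%:R :> R by rewrite ler_nat card_le_n.
case: inv => [[nm _]|[mn [[Sle dT]|[T0 _]]]].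
- by move: nm; rewrite leNgt (lt_le_trans mT Tn).
- right; split=> //; right; split=> //.
  apply: (@le_trans _ _ (#|S|%:R + #|T|%:R)).
    by rewrite -natrD ler_nat leq_card_setU.
  have xT : x + m%:R <= 2 * k%:R / kappa ^+ 3 * (2 / delta).
    by apply: (last_size_le (u := u)) => //; rewrite ?/x; lra.
  have := psi_le_budget mn Sle dT; have := log_ge0 mn.
  move: xT; rewrite /x subrK /budget; set L := ln _; set D := 2 / delta => xT L0.
  have c0 : 0 <= k%:R / kappa ^+ 3 by rewrite divr_ge0 ?exprn_ge0 ?ler0n // ltW.
  have -> : 18 * k%:R / kappa ^+ 3 = 18 * (k%:R / kappa ^+ 3) by rewrite mulrA.
  have -> : 16 * k%:R / kappa ^+ 3 = 16 * (k%:R / kappa ^+ 3) by rewrite mulrA.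
  move: xT; have -> : 2 * k%:R / kappa ^+ 3 = 2 * (k%:R / kappa ^+ 3) by rewrite mulrA.
  by move: (_ / _) c0 => c c0; nra.
by move: mT; rewrite T0 cards0; nra.
Qed.

Lemma round_spec s T S pi (u : nat) :
    env s -> isset s vT T -> isset s vS S -> nmem s vt 0%N 0%N = #|T| ->
    nmem s vu 0%N 0%N = u -> u_spec u -> (1 + delta) * m%:R < #|T|%:R ->
    charged A k eta kappa m T S pi -> size_inv T S ->
  let s' := exec round_prog s in
  exists T' S' pi', [/\ isset s' vT T', isset s' vS S', charged A k eta kappa m T' S' pi',
    size_inv T' S' & (#|T'| < #|T|)%N].
Proof.
move=> es sT sS st su us mT chg inv; rewrite /round_prog exec_seq.
have Tn : (#|T| <= n)%N by apply: card_le_n.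
have T0 : (0 < #|T|)%N by rewrite -(ltr_nat R); have := m0; have := delta_gt0; nra.
have n0 : (0 < n)%N := leq_trans T0 Tn.
have [u0 uk] := u_bounds n0 us.
have mT' : (m < #|T|)%N by rewrite -(ltr_nat R); have := m0; have := delta_gt0; nra.
have := p_prog_spec es st su us Tn T0.
have ss1 := exec_same p_prog s; have es1 : env (exec p_prog s) by apply: exec_env es.
move: (exec p_prog s) ss1 es1 => s1 ss1 es1; set p := nmem s1 vp 0%N 0%N.
move=> [pn pu pu1 ku].
have sT1 : isset s1 vT T by apply: isset_same ss1 _ sT.
have sS1 : isset s1 vS S by apply: isset_same ss1 _ sS.
have su1 : nmem s1 vu 0%N 0%N = u by rewrite (ss1.1 vu isT).
have st1 : nmem s1 vt 0%N 0%N = #|T| by rewrite (ss1.1 vt isT).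
rewrite exec_if; have -> : beval s1 (NLt (NLit 0) (scalar vp)) = (0 < p)%N by [].
case: ifP => p0; last first.
  rewrite exec_seq; have pz : p = 0%N by apply/eqP; rewrite -leqn0 leqNgt p0.
  set s2 := exec _ s1; have es2 : env s2 by apply: exec_env es1.
  have sS2 : isset s2 vS (S :|: T) by apply: union_spec.
  clearbody s2; set cl := setfor_prog _ _.
  have ss3 := exec_same cl s2.
  have sT3 : isset (exec cl s2) vT finset.set0 by apply: setfor_spec => // j *; rewrite inE.
  exists finset.set0, (S :|: T), (fun i => if i \in T then 0 else pi i); split=> //.
  - exact: isset_same ss3 _ sS2.
  - exact: charged_finish chg.
  - apply: (size_inv_finish inv mT uk); rewrite ltW //.
    by move: pu1; rewrite pz add0r mul1r.
  - by rewrite cards0.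
have {}pu := pu p0; have {ku}[ku en] := ku p0.
have puT : (p * u <= #|T| - m)%N.
  rewrite -(ler_nat R); apply: le_trans pu _.
  by rewrite ler_piMl //; have := kappa_le; have := kappa_gt0; lra.
rewrite 4!exec_seq.
have := g_prog_spec es1 erefl pn; rewrite su1.
have ss2 := exec_same g_prog s1; have es2 : env (exec g_prog s1) by apply: exec_env es1.
move: (exec g_prog s1) ss2 es2 => s2 ss2 es2 sg2.
have sT2 : isset s2 vT T by apply: isset_same ss2 _ sT1.
have sS2 : isset s2 vS S by apply: isset_same ss2 _ sS1.
have sp2 : nmem s2 vp 0%N 0%N = p by rewrite (ss2.1 vp isT).
have st2 : nmem s2 vt 0%N 0%N = #|T| by rewrite (ss2.1 vt isT).
have guT : (p * u <= #|T|)%N := leq_trans puT (leq_subr _ _).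
have := b_prog_spec es2 st2 sg2 sp2 p0 Tn guT.
have ss3 := exec_same b_prog s2; have es3 : env (exec b_prog s2) by apply: exec_env es2.
move: (exec b_prog s2) ss3 es3 => s3 ss3 es3; set b := nmem s3 vb 0%N 0%N.
move=> [pb pbT].
have sT3 : isset s3 vT T by apply: isset_same ss3 _ sT2.
have sS3 : isset s3 vS S by apply: isset_same ss3 _ sS2.
have sp3 : nmem s3 vp 0%N 0%N = p by rewrite (ss3.1 vp isT).
have sg3 : nmem s3 vg 0%N 0%N = (p * u)%N by rewrite (ss3.1 vg isT).
have pbT' : (p * b <= #|T|)%N := leq_trans pb (leq_subr _ _).
have := blocks_prog_spec eps_gt0 eps_le1 n0 en es3 sT3 erefl sp3 pn pbT' p0 u0 ku.
have ss4 := exec_same blocks_prog s3; have es4 : env (exec blocks_prog s3) by apply: exec_env es3.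
move: (exec blocks_prog s3) ss4 es4 => s4 ss4 es4 [T' [Bb [Tb [sBb4 sTb4 binv]]]].
have sT4 : isset s4 vT T by apply: isset_same ss4 _ sT3.
have sS4 : isset s4 vS S by apply: isset_same ss4 _ sS3.
have sg4 : nmem s4 vg 0%N 0%N = (p * u)%N by rewrite (ss4.1 vg isT).
have [cBb TbT cTb Tbnu] : [/\ #|Bb| = b, Tb \subset T, (#|T| - p * b <= #|Tb|)%N
    & forall i, i \in Tb -> resid Bb i <= rmem s4 rnub 0%N 0%N].
  by have [_ _ /(_ p0)] := binv.
have gTb : (p * u <= #|Tb|)%N.
  by apply: leq_trans cTb; rewrite leq_subRL // addnC -leq_subRL.
set un := union_prog _ _; have ss5 := exec_same un s4.
have es5 : env (exec un s4) by apply: exec_env es4.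
have sS5 : isset (exec un s4) vS (S :|: Bb) by apply: union_spec.
move: (exec un s4) ss5 es5 sS5 => s5 ss5 es5 sS5.
have sT5 : isset s5 vT T by apply: isset_same ss5 _ sT4.
have sTb5 : isset s5 vTb Tb by apply: isset_same ss5 _ sTb4.
have sg5 : nmem s5 vg 0%N 0%N = (p * u)%N by rewrite (ss5.1 vg isT).
have [G [GTb cG sT6]] := remove_spec es5 sT5 sTb5 sg5 gTb.
have ss6 := exec_same remove_prog s5.
have GT : G \subset T := fintype.subset_trans GTb TbT.
(* The columns of [G] remained after the best block was taken off, so its price bounds their
   residuals. *)
exists (T :\: G), (S :|: Bb), (fun i => if i \in G then rmem s4 rnub 0%N 0%N else pi i).
split=> //.
- exact: isset_same ss6 _ sS5.
- apply: (charged_round eta_ge0 kappa_gt0 kappa_le chg TbT GTb Tbnu); rewrite cG //.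
  move=> X v J rX JT cJ Jv.
  apply: (block_inv_end eta_ge0 kappa_gt0 kappa_le binv p0 u0 pbT rX JT cJ Jv).
- by apply: (size_inv_round (b := b) inv mT GT cG _ pb p0 u0 uk pu pu1); rewrite cBb.
- by rewrite cardsD (finset.setIidPr GT) cG -subn_gt0 subKn // muln_gt0 p0 u0.
Qed.

Lemma main_spec s (u : nat) :
    env s -> isset s vT [set: 'I_n] -> isset s vS finset.set0 ->
    nmem s vu 0%N 0%N = u -> u_spec u ->
  let s' := exec main_prog s in
  exists T S pi, [/\ isset s' vT T, isset s' vS S, charged A k eta kappa m T S pi,
    size_inv T S & #|T|%:R <= (1 + delta) * m%:R].
Proof.
move=> es sT sS su us.
pose P (i : nat) s' := exists T S pi,
  [/\ isset s' vT T, isset s' vS S, charged A k eta kappa m T S pi, size_inv T S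
    & #|T|%:R <= (1 + delta) * m%:R \/ (#|T| + i <= n)%N].
suff : P n (exec main_prog s).
  case=> T [S [pi [sT' sS' chg inv Tn]]]; exists T, S, pi; split=> //.
  case: Tn => //; rewrite -[leqRHS]add0n leq_add2r leqn0 => /eqP ->.
  by rewrite mulr_ge0 ?ler0n // addr_ge0 // ltW.
apply: for_n => //.
  exists [set: 'I_n], finset.set0, (fun=> 0); split=> //.
  - exact: charged0.
  - rewrite /size_inv cardsT card_ord; case: (leP n%:R ((1 + delta) * m%:R)) => nm; [by left|right].
    split=> //; left; rewrite cards0 subrr mulr0; split=> //.
    by have := m0; have := delta_gt0; nra.
  - by right; rewrite addn0 cardsT card_ord.
move=> i s' s'i es' ss' [T [S [pi [sT' sS' chg inv Tn]]]].
rewrite exec_seq; have ss1 := exec_same (card_prog vt vT) s'.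
have st1 := @card_spec vt vT s' T es' isT isT isT sT'.
have es1 : env (exec (card_prog vt vT) s') by apply: exec_env es'.
move: (exec (card_prog vt vT) s') ss1 st1 es1 => s1 ss1 st1 es1.
have sT1 : isset s1 vT T by apply: isset_same ss1 _ sT'.
have sS1 : isset s1 vS S by apply: isset_same ss1 _ sS'.
have su1 : nmem s1 vu 0%N 0%N = u by rewrite (ss1.1 vu isT) (ss'.1 vu isT).
have tE : beval s1 main_test = ((1 + delta) * m%:R < #|T|%:R).
  by have [[_ _ _ e3] [_ _ e5]] := es1; rewrite /= e3 e5 st1.
rewrite exec_if tE; case: ifP => mT; last first.
  exists T, S, pi; split=> //; left.
  by rewrite leNgt mT.
have [T2 [S2 [pi2 [? ? ? ? cT2]]]] := round_spec es1 sT1 sS1 st1 su1 us mT chg inv.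
exists T2, S2, pi2; split=> //; right.
case: Tn => [|Tn]; first by rewrite leNgt mT.
by rewrite addnS; apply: leq_trans Tn; rewrite -addSn leq_add2r.
Qed.

Lemma output_spec s T S : env s -> isset s vT T -> isset s vS S ->
    (forall x i j, (3 <= x <= 5)%N -> rmem s x i j = 0) ->
  let s' := exec output_prog s in
  forall (i : 'I_d) (j : 'I_n),
  [/\ rmem s' 3%N i j = if j \in T then 0 else A i j,
      rmem s' 4%N i j = if j \in T then A i j else 0 &
      rmem s' 5%N i j = if j \in S then A i j else 0].
Proof.
move=> es sT sS s0.
pose out s' (i : 'I_d) (j : 'I_n) (b : bool) :=
  [/\ rmem s' 3%N i j = if b && (j \notin T) then A i j else 0,
      rmem s' 4%N i j = if b && (j \in T) then A i j else 0 &
      rmem s' 5%N i j = if b && (j \in S) then A i j else 0].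
pose P (j : nat) s' := forall (i : 'I_d) (j' : 'I_n), out s' i j' (j' < j)%N.
suff H : P n (exec output_prog s).
  move=> s' i j; have [] := H i j; rewrite ltn_ord /= => -> -> ->.
  by split=> //; case: (j \in T).
apply: for_n => //.
  by move=> i j; rewrite /out ltn0 /= !s0.
move=> j s' s'j es' ss' Pj; set body := PFor 0 22 _.
pose Q (i : nat) s'' := forall (i' : 'I_d) (j' : 'I_n),
  out s'' i' j' ((j' < j)%N || (j' == j) && (i' < i)%N).
suff H : Q d (exec body s').
  by move=> i j'; have := H i j'; rewrite ltS_ord ltn_ord andbT orbC.
apply: for_d => //; first by move=> i j'; rewrite ltn0 andbF orbF; apply: Pj.
move=> i s'' s''i es'' ss'' Qi i' j'.
have s''j : nmem s'' 21%N 0%N 0%N = j by rewrite (ss''.1 21%N isT).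
have sT'' : nmem s'' vT j 0%N = (j \in T) by rewrite (ss''.1 vT isT) (ss'.1 vT isT) sT.
have sS'' : nmem s'' vS j 0%N = (j \in S) by rewrite (ss''.1 vS isT) (ss'.1 vS isT) sS.
have AE : rmem s'' 0%N i j = A i j by have [_ [-> _ _]] := es''.
have [Q3 Q4 Q5] := Qi i' j'.
have bT : beval s'' (NLt (NLit 0) (entry vT 21)) = (j \in T) by rewrite /= s''j sT'' lt0b.
rewrite exec_seq; set s3 := exec _ s''.
have s3E : s3 = exec (output_entry (if j \in T then 4 else 3)%N) s''.
  by rewrite /s3 exec_if bT; case: ifP.
have n3 : nmem s3 = nmem s'' by rewrite s3E.
have r3 x a b : rmem s3 x a b
    = if [&& x == (if j \in T then 4 else 3)%N, a == val i & b == val j] then A i j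
      else rmem s'' x a b.
  by rewrite s3E /= /upd /= s''i s''j AE.
have bS : beval s3 (NLt (NLit 0) (entry vS 21)) = (j \in S) by rewrite /= n3 s''j sS'' lt0b.
rewrite exec_if bS; set s4 := (if _ then exec _ s3 else _).
have r4 x a b : rmem s4 x a b
    = if [&& j \in S, x == 5%N, a == val i & b == val j] then A i j else rmem s3 x a b.
  rewrite /s4; case: ifP => jS //=.
  by rewrite /upd /= n3 s''i s''j r3 AE; case: (j \in T).
clearbody s4 s3.
rewrite /out !r4 !r3 Q3 Q4 Q5 ltS_ord.
have -> : (val j' == val j) = (j' == j) by rewrite (inj_eq val_inj).
have -> : (val i' == val i) = (i' == i) by rewrite (inj_eq val_inj).
case: (eqVneq j' j) => [->|jj']; last by rewrite !andbF /=.
case: (eqVneq i' i) => [->|ii'] /=; last by rewrite !andbF.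
by case: (j \in T); case: (j \in S); rewrite /= ?ltnn /=.
Qed.

Lemma input_env : env (input_state A k m eps delta).
Proof. by split; split=> // i j; rewrite /= !valK. Qed.

Lemma pca_prog_spec :
  let s := exec pca_prog (input_state A k m eps delta) in
  exists T S pi, [/\ charged A k eta kappa m T S pi, size_inv T S,
    #|T|%:R <= (1 + delta) * m%:R &
    forall (i : 'I_d) (j : 'I_n),
      [/\ rmem s 3%N i j = if j \in T then 0 else A i j,
          rmem s 4%N i j = if j \in T then A i j else 0 &
          rmem s 5%N i j = if j \in S then A i j else 0]].
Proof.
have es := input_env; set s := input_state _ _ _ _ _ in es *.
have sS : isset s vS finset.set0 by move=> j; rewrite inE /s /=; case: ifP.
have s0 x i j : (3 <= x <= 5)%N -> rmem s x i j = 0 by case: x => [|[|[|]]].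
clearbody s; rewrite /pca_prog 3!exec_seq.
set fill := setfor_prog _ _.
have sT1 : isset (exec fill s) vT [set: 'I_n] by apply: setfor_spec => // j *; rewrite inE.
have ss1 := exec_same fill s; have es1 : env (exec fill s) by apply: exec_env es.
move: (exec fill s) ss1 es1 sT1 => s1 ss1 es1 sT1.
have us := u_prog_spec es1.
have ss2 := exec_same u_prog s1; have es2 : env (exec u_prog s1) by apply: exec_env es1.
move: (exec u_prog s1) ss2 es2 us => s2 ss2 es2 us.
have sT2 : isset s2 vT [set: 'I_n] by apply: isset_same ss2 _ sT1.
have sS2 : isset s2 vS finset.set0.
  by apply: isset_same ss2 _ _ => //; apply: isset_same ss1 _ sS.
have := main_spec es2 sT2 sS2 erefl us.
have ss3 := exec_same main_prog s2; have es3 : env (exec main_prog s2) by apply: exec_env es2.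
move: (exec main_prog s2) ss3 es3 => s3 ss3 es3 [T [S [pi [sT3 sS3 chg inv Tm]]]].
exists T, S, pi; split=> //; apply: output_spec => // x i j x35.
(* The output arrays 3 to 5 are still zero when the output phase begins, since the earlier phases
   write only real arrays from 6 on. *)
have low p : all (leq 6) (wreal p) -> x \notin wreal p.
  move=> /allP p6; apply/negP => /p6; case/andP: x35 => _ x5.
  by rewrite leqNgt ltnS x5.
by rewrite (ss3.2 _ (low main_prog isT)) (ss2.2 _ (low u_prog isT)) (ss1.2 _ (low fill isT)) s0.
Qed.

End Correctness.

End Environment.

(** * From column costs to Frobenius norms, and the conclusion *)

Lemma frob2_cols (R : realType) (d n : nat) (M : 'M[R]_(d, n)) :
  frob2 M = \sum_j dotv (col j M) (col j M).
Proof.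
rewrite /frob2 exchange_big; apply: eq_bigr => j _.
by rewrite dotvE; apply: eq_bigr => i _; rewrite !mxE expr2.
Qed.

Lemma col_span_mask (R : realType) (d n : nat) (A M : 'M[R]_(d, n)) (S : {set 'I_n}) :
    (forall j, col j M = if j \in S then col j A else 0) ->
  col_span M [set: 'I_n] = col_span A S.
Proof.
move=> ME; apply/eqP; rewrite eqEsubv; apply/andP; split; apply/span_subvP => v /mapP[j].
  move=> _ ->; rewrite ME; case: ifP => [jS|_]; last exact: mem0v.
  exact: mem_col_span.
rewrite mem_enum => jS ->; have := ME j; rewrite jS => <-.
by apply: mem_col_span; rewrite inE.
Qed.

Theorem theorem2 (R : realType) :
  exists (P : cmd) (c : nat) (C : R),
  forall (d n : nat) (A : 'M[R]_(d, n)) (k m : nat) (eps delta : R),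
    (0 < k)%N -> (0 < m)%N -> 0 < eps <= 1 -> 0 < delta <= 1 ->
  exists (s : state R) (B' N' : 'M[R]_(d, n)) (V : {vspace 'cV[R]_d}),
    halts_within P (input_state A k m eps delta) (c * (d + n).+1 ^ c)%N s /\
    outputs s B' N' V /\
    column_split A B' N' /\
    (#|nzcols N'|%:R <= (1 + delta) * m%:R) /\
    (forall B N Bk : 'M[R]_(d, n), optimal_decomp A k m B N Bk ->
      frob2 (map_cols (perp_proj V) B') <= (1 + eps) * frob2 (B - Bk)) /\
    (exists S : {set 'I_n},
      V = col_span A S /\
      #|S|%:R <= C * (k%:R / eps ^+ 6
                      * Num.max 0 (ln (n%:R / m%:R) + 2 / delta))).
Proof.
have wfp : wf pca_prog by [].
have [c cP] := halts_compile R wfp.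
(* The constant is that of [budget], with [16 ^+ 3] coming from [kappa = eps / 16]. *)
exists (compile pca_prog), c, (18 * 16 ^+ 3) => d n A k m eps delta k0 m0 /andP[e0 e1] /andP[d0 d1].
have [T [S [pi [chg inv Tm out]]]] := pca_prog_spec A k0 m0 e0 e1 d0 d1.
have run := cP (input_state A k m eps delta) d n erefl erefl.
move: (exec pca_prog _) run out => s run out.
have B'E j : col j (read_mx s 3 d n) = if j \in T then 0 else col j A.
  by apply/colP => i; rewrite !mxE; have [-> _ _] := out i j; case: ifP; rewrite mxE.
have N'E j : col j (read_mx s 4 d n) = if j \in T then col j A else 0.
  by apply/colP => i; rewrite !mxE; have [_ -> _] := out i j; case: ifP; rewrite mxE.
have ME j : col j (read_mx s 5 d n) = if j \in S then col j A else 0.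
  by apply/colP => i; rewrite !mxE; have [_ _ ->] := out i j; case: ifP; rewrite mxE.
exists s, (read_mx s 3 d n), (read_mx s 4 d n), (col_span A S).
split; first exact: run.
split; first by split=> //; rewrite (col_span_mask ME).
split.
  split=> [|j]; last by rewrite B'E N'E; case: ifP; [right|left].
  apply/matrixP => i j; rewrite !mxE; have [-> -> _] := out i j.
  by case: ifP; rewrite ?add0r ?addr0.
split.
  apply: le_trans Tm; rewrite ler_nat; apply: subset_leq_card; apply/fintype.subsetP => j.
  by rewrite inE N'E; case: (j \in T); rewrite ?eqxx.
split; last first.
  (* If no round was needed then [S] is empty and the maximum with 0 suffices, even where the
     logarithm is negative. *)
  exists S; split=> //; case: (size_inv_budget m0 e0 d0 d1 inv) => [->|[mn Sle]].
    by rewrite cards0 !mulr_ge0 ?ler0n ?invr_ge0 ?exprn_ge0 ?le_max ?lexx // ltW.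
  exact: size_le_budget.
move=> B N Bk [[_ Nm BE] [rBk _] _].
have eta0 : 0 <= eps / 8 by rewrite divr_ge0 // ltW.
have kap0 : 0 < eps / 16 by rewrite divr_gt0.
have kap1 : 16 * (eps / 16) <= 1 by rewrite mulrC divfK.
(* The charging argument is applied to the inliers of the given decomposition and to the rank-[k]
   matrix [Bk]. *)
have cI : (#|~: ~: nzcols N| <= m)%N by rewrite finset.setCK.
have := charged_sum eta0 kap0 kap1 chg rBk cI.
have -> : \sum_(i in ~: T) dist2 (col_span A S) (col i A)
    = frob2 (map_cols (perp_proj (col_span A S)) (read_mx s 3 d n)).
  rewrite frob2_cols [RHS](bigID (mem T)) /= [X in _ = X + _]big1 ?add0r => [|j jT].
    apply: eq_big => [j|j jT]; first by rewrite inE.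
    have jT' : j \notin T by rewrite inE in jT.
    rewrite /dist2; congr dotv; apply/colP => i; by rewrite !mxE B'E (negPf jT').
  have -> : col j (map_cols (perp_proj (col_span A S)) (read_mx s 3 d n)) = 0.
    by apply/colP => i; rewrite !mxE B'E jT linear0 mxE.
  by rewrite linear0l.
(* On inliers the columns of [A] and [B] agree; the outlier columns only add nonnegative terms on
   the right. *)
have : \sum_(j in ~: nzcols N) err A Bk j <= frob2 (B - Bk).
  rewrite frob2_cols [leRHS](bigID (mem (~: nzcols N))) /= -[leLHS]addr0 lerD //.
    rewrite le_eqVlt; apply/orP; left; apply/eqP/eq_bigr => j; rewrite inE => jN.
    by rewrite /err linearB /= BE (negPf jN).
  by apply: sumr_ge0 => j _; apply: dotvv_ge0.
have := eps_budget kap0 kap1.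
set F := frob2 _; set E := \sum_(j in _) _; set G := frob2 _.
rewrite [16 * _]mulrC divfK //; set q := (1 - _) * _ => eq EG.
have q0 : 0 < q by rewrite mulr_gt0 ?exprn_gt0 //; lra.
have F0 : 0 <= F by rewrite /F frob2_cols sumr_ge0 // => j _; apply: dotvv_ge0.
have e1' : 0 <= 1 + eps / 8 by lra.
move=> /le_trans/(_ (ler_wpM2l e1' EG)) qF.
rewrite -(ler_pM2l q0); apply: le_trans qF _.
rewrite mulrA; apply: ler_wpM2r => //.
by rewrite mulrC; move: eq; lra.
Qed.
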